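(* Let $\underline{E}\neq 0$ be a constant. For $k=|\xi|$, $\xi\in\mathbb{R}^2$, consider the homogeneous system $$ \begin{cases} i\partial_z u-k^2u-\underline{E}\,n=0,\\ i\partial_z v+k^2v+\overline{\underline{E}}\,n=0,\\ (\partial_t^2+k^2)n+k^2\underline{E}\,(u+v)=0, \end{cases} $$ with initial-boundary conditions $$ n_{|t=0}=0,\quad \partial_tn_{|t=0}=0,\quad u_{|z=0}=u_0,\quad v_{|z=0}=v_0 . $$ There are initial data $|u_0|\le 1$ and $v_0=0$ such that for $k$ large, $t\ge\frac12$ and $\rho:=\sqrt{2k|\underline{E}|^2zt}$ large, the solution of this homogeneous problem satisfies $$|n(t,z)|\ \gtrsim\ k\,\rho^{-\frac52}\,e^{\rho}.$$
   Context: The unknowns $u,v,n$ are functions of $(t,z)$ with $t\ge 0$, $z\ge 0$; the data $u_0,v_0$ are functions of $t$, prescribed at the frequency $k$. The symbol $\gtrsim$ means $\ge$ up to a positive multiplicative constant. The initial-boundary value problem is a well-posed hyperbolic Goursat problem. The system is presented as the homogeneous linearization, at the Fourier frequency $\xi$ in the variable $x$, of the equations $i\partial_zE+\Delta_xE=nE$, $(\partial_t^2-\Delta_x)n=\Delta_x|E|^2$ around the constant solution $(E,n)=(\underline{E},0)$; here $u$, $v$ and $n$ denote the Fourier coefficients at frequency $\xi$ of the variations of $E$, of $\overline{E}$ and of the density.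
   Formalization: The third equation's coupling is taken as k²(conj(E)u+Ev), equal to the printed k²E(u+v) for real E; ''k large'' means k≥K with K depending on upper bounds of t and z, since the printed coupling for non-real E and uniformity in all t, z make the claim false. *)

(* Defs.v *)
From Stdlib Require Import Reals.
From Coquelicot Require Import Coquelicot.

Open Scope R_scope.

(* Derivative on the half-line [0, +oo): two-sided at x > 0, and the right
   derivative at x = 0. *)
Definition is_derive_half (f : R -> C) (x : R) (l : C) : Prop :=
  @filterdiff R_AbsRing R_NormedModule C_R_NormedModule f
    (within (fun y => 0 <= y) (locally x))
    (fun y => @scal R_AbsRing C_R_NormedModule y l).

Definition quadrant (p : R * R) : Prop := 0 <= fst p /\ 0 <= snd p.

Definition continuous_on_quadrant (f : R -> R -> C) : Prop :=
  forall p : R * R, quadrant p ->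
    filterlim (fun q : R * R => f (fst q) (snd q))
      (within quadrant (locally p)) (locally (f (fst p) (snd p))).

(* Classical solutions, on t >= 0, z >= 0, of the linearization at frequency k
   of  i d_z E + Delta_x E = n E,  (d_t^2 - Delta_x) n = Delta_x |E|^2
   around the constant state (E, 0).  The functions take t first, then z.
   The variation of |E|^2 is conj(E) u + E v, which is E (u + v) when E is
   real.  The remaining regularity (continuity of d_z u, d_z v, d_t n and
   d_t^2 n) follows from the equations. *)
Record zakharov_solution (E : C) (k : R) (u0 v0 : R -> C)
    (u v n : R -> R -> C) : Prop := {
  zak_cont_u : continuous_on_quadrant u;
  zak_cont_v : continuous_on_quadrant v;
  zak_cont_n : continuous_on_quadrant n;
  zak_eq_u : forall t z : R, 0 <= t -> 0 <= z ->
    exists uz : C, is_derive_half (fun y => u t y) z uz /\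
      (Ci * uz - RtoC (k ^ 2) * u t z - E * n t z = 0)%C;
  zak_eq_v : forall t z : R, 0 <= t -> 0 <= z ->
    exists vz : C, is_derive_half (fun y => v t y) z vz /\
      (Ci * vz + RtoC (k ^ 2) * v t z + Cconj E * n t z = 0)%C;
  zak_eq_n : exists nt : R -> R -> C,
    (forall t z : R, 0 <= t -> 0 <= z ->
       is_derive_half (fun s => n s z) t (nt t z)) /\
    (forall t z : R, 0 <= t -> 0 <= z ->
       exists ntt : C, is_derive_half (fun s => nt s z) t ntt /\
         (ntt + RtoC (k ^ 2) * n t z
            + RtoC (k ^ 2) * (Cconj E * u t z + E * v t z) = 0)%C) /\
    (forall z : R, 0 <= z -> nt 0 z = RtoC 0);
  zak_init_n : forall z : R, 0 <= z -> n 0 z = RtoC 0;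
  zak_init_u : forall t : R, 0 <= t -> u t 0 = u0 t;
  zak_init_v : forall t : R, 0 <= t -> v t 0 = v0 t
}.

Definition freq (xi : R * R) : R := sqrt (fst xi ^ 2 + snd xi ^ 2).

Definition rho (E : C) (k t z : R) : R := sqrt (2 * k * Cmod E ^ 2 * z * t).

(* Main.v *)
Require Import Defs.
From Stdlib Require Import Reals.
From Coquelicot Require Import Coquelicot.
From Stdlib Require Import Psatz Factorial IndefiniteDescription.

Open Scope R_scope.

(** Why the solution grows like [exp rho].

    Write [A = |E|^2] and [w = conj(E) u + E v].  Eliminating the difference
    [conj(E) u - E v] turns the system into the symmetric pair
      [(d_t^2 + k^2) n = - k^2 w]   and   [(d_z^2 + k^4) w = - 2 A k^2 n],
    a harmonic oscillator in each variable, each one forced by the other.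
    Let [F_0 (x) = exp (i x)] and let [F_(j+1)] solve [F'' + F = F_j] from
    rest (this is [osc]).  For the datum [u_0 = exp (i k t)], [v_0 = 0],
    separation of variables gives the exact solution
      [n = - conj(E) * sum_j (2 A / k^2)^j F_(j+1) (k t) conj (F_j (k^2 z))]
    ([zakharov_exists]).  Each forcing is resonant, so [F_j] grows: it is close
    to [exp (i x) (x / (2 i))^j / j!].  Inserting this, the powers of [i] cancel
    between the two factors and all terms line up:
      [|n| ~ |E| (k t / 2) sum_j q^j / (j! (j+1)!)],   [q = rho^2 / 4],
    a modified Bessel series, which is at least [exp rho / (2 rho^2)]
    ([Series_weight_ge_exp]); [rho^(-2)] dominates [rho^(-5/2)].

    What has to be shown is that the corrections to [F_j] do not destroy this
    alignment.  Write [F_j (x) = (x/2)^j / j! * (- i)^j * profile j x].  The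
    profile obeys a first-order recursion in [j] with increments [O(j/x)];
    its first two properties below come from there, the third from the
    differential equation ([Cmod_osc_le]).
    - It is within [exp (j^2 / x) - 1] of [exp (i x)] ([Cmod_profile_exp]).  The
      relevant [j] are of order [rho], hence of order [sqrt k], so this settles
      the factor at [x = k^2 z], where [j^2 / x] is of order [1 / k].
    - It is close to [exp (i x) exp (i j^2 / (2 x))] for [x] large and [j^2 = O(x)]
      ([profile_asymptotics]).  At [x = k t] the extra phase is of order one.
      Under the weights [q^j / (j! (j+1)!)], however, [j (j+1)] has mean exactly
      [q] and variance at most [rho^3] ([Series_variance_le]), so the phase
      fluctuates by [O(rho^(3/2) / k)] only and acts as a common factor of
      modulus one.
    - It is at most [2^j] in modulus ([Cmod_profile_pow2]), which makes the terms
      [j > 4 rho] negligible.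
    Hence at least half of the Bessel sum survives ([profile_sum_lower]).
    Finally any other solution with the same data has the same [n]
    ([zakharov_unique]). *)

(** * Complex numbers *)

Lemma re_le_Cmod (z : C) : fst z <= Cmod z.
Proof.
  eapply Rle_trans; [apply Rle_abs|].
  eapply Rle_trans; [|apply Rmax_Cmod]. apply Rmax_l.
Qed.

Lemma Cmod_Ci : Cmod Ci = 1.
Proof.
  unfold Cmod. transitivity (sqrt 1); [apply (f_equal sqrt); simpl; ring|].
  apply sqrt_1.
Qed.

Lemma Cmod_le_sum (z : C) : Cmod z <= Rabs (fst z) + Rabs (snd z).
Proof.
  destruct z as [a b].
  assert (Hab : (a, b) = (RtoC a + Ci * RtoC b)%C)
    by (apply injective_projections; simpl; ring).
  cbn [fst snd]. rewrite Hab.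
  eapply Rle_trans; [apply Cmod_triangle|].
  rewrite Cmod_mult, !Cmod_R.
  rewrite Cmod_Ci. simpl. lra.
Qed.

Lemma Cminus_eq_0 (a b : C) : (a - b = 0)%C -> a = b.
Proof.
  intros H. replace a with (a - b + b)%C by ring. rewrite H. ring.
Qed.

Lemma Ci_mult_eq (w b : C) : (Ci * w - b = 0)%C -> w = (- Ci * b)%C.
Proof.
  intros H. apply Cminus_eq_0 in H. subst b.
  apply injective_projections; simpl; ring.
Qed.

Definition cis (y : R) : C := (cos y, sin y).

Lemma Cmod_cis (y : R) : Cmod (cis y) = 1.
Proof.
  unfold cis, Cmod. cbn [fst snd]. rewrite <- sqrt_1. f_equal.
  pose proof (sin2_cos2 y). unfold Rsqr in *. lra.
Qed.

Lemma cis_plus (a b : R) : cis (a + b) = (cis a * cis b)%C.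
Proof.
  unfold cis. rewrite cos_plus, sin_plus. apply injective_projections; simpl; ring.
Qed.

Lemma cis_0 : cis 0 = 1.
Proof. unfold cis. now rewrite cos_0, sin_0. Qed.

Lemma exp_le_exp (a b : R) : a <= b -> exp a <= exp b.
Proof.
  intros [H| ->]; [left; now apply exp_increasing|lra].
Qed.

(** * Derivatives on the half-line *)

(** The real normed-module structure on [C] that [is_derive_half] refers to is the
    product one. *)
Lemma Cmod_prod_norm (z : C) :
  @norm R_AbsRing C_R_NormedModule z = Cmod z.
Proof.
  destruct z as [a b].
  change (sqrt (Rabs a ^ 2 + Rabs b ^ 2) = sqrt (a ^ 2 + b ^ 2)).
  now rewrite !pow2_abs.
Qed.

Lemma is_derive_half_eps (f : R -> C) (x : R) (l : C) : 0 <= x ->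
  (is_derive_half f x l <->
   forall eps : R, 0 < eps -> exists d : R, 0 < d /\
     forall y : R, 0 <= y -> Rabs (y - x) < d ->
       Cmod (f y - f x - RtoC (y - x) * l)%C <= eps * Rabs (y - x)).
Proof.
  intros Hx.
  assert (Hsc : forall y : R,
    @norm R_AbsRing C_R_NormedModule
      (minus (minus (f y) (f x)) (scal (minus y x) l))
    = Cmod (f y - f x - RtoC (y - x) * l)%C).
  { intros y. rewrite Cmod_prod_norm. f_equal.
    rewrite <- scal_R_Cmult. reflexivity. }
  split.
  - intros [_ H] eps Heps.
    assert (Hlim : is_filter_lim (within (fun y => 0 <= y) (locally x)) x).
    { intros P HP. unfold within. revert HP. apply filter_imp. auto. }
    destruct (H x Hlim (mkposreal eps Heps)) as [d Hd].
    exists d. split; [apply cond_pos|].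
    intros y Hy Hyx. eapply Rle_trans; [right; symmetry; apply Hsc|].
    apply (Hd y Hyx Hy).
  - intros H. split.
    + apply is_linear_scal_l.
    + intros x' Hx' eps.
      assert (x' = x).
      { destruct (Req_dec x' x) as [|Hne]; auto. exfalso.
        assert (Hp : 0 < Rabs (x' - x) / 2)
          by (assert (x' - x <> 0) by lra; pose proof (Rabs_pos_lt _ H0); lra).
        destruct (Hx' (ball x' (mkposreal _ Hp)) (locally_ball _ _)) as [d Hd].
        assert (Hin : ball x' (mkposreal _ Hp) x).
        { apply Hd; auto. apply ball_center. }
        change (Rabs (x - x') < Rabs (x' - x) / 2) in Hin.
        rewrite Rabs_minus_sym in Hin. lra. }
      subst x'.
      destruct (H eps (cond_pos eps)) as [d [Hd0 Hd]].
      exists (mkposreal d Hd0). intros y Hyx Hy.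
      eapply Rle_trans; [right; apply Hsc|]. apply (Hd y Hy Hyx).
Qed.

Lemma is_derive_half_minus (f g : R -> C) (x : R) (l m : C) : 0 <= x ->
  is_derive_half f x l -> is_derive_half g x m ->
  is_derive_half (fun y => f y - g y)%C x (l - m)%C.
Proof.
  intros Hx Hf Hg.
  rewrite is_derive_half_eps in * by assumption.
  intros eps Heps.
  destruct (Hf (eps / 2)) as [d1 [H1 Hd1]]; [lra|].
  destruct (Hg (eps / 2)) as [d2 [H2 Hd2]]; [lra|].
  exists (Rmin d1 d2). split; [now apply Rmin_pos|].
  intros y Hy Hyx.
  specialize (Hd1 y Hy (Rlt_le_trans _ _ _ Hyx (Rmin_l _ _))).
  specialize (Hd2 y Hy (Rlt_le_trans _ _ _ Hyx (Rmin_r _ _))).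
  replace (f y - g y - (f x - g x) - RtoC (y - x) * (l - m))%C
    with ((f y - f x - RtoC (y - x) * l) + - (g y - g x - RtoC (y - x) * m))%C
    by ring.
  eapply Rle_trans; [apply Cmod_triangle|]. rewrite Cmod_opp. lra.
Qed.

Lemma is_derive_half_pair (f g : R -> R) (x l m : R) : 0 <= x ->
  is_derive f x l -> is_derive g x m ->
  is_derive_half (fun y => (f y, g y)) x (l, m).
Proof.
  intros Hx [_ Hf] [_ Hg].
  rewrite is_derive_half_eps by assumption.
  intros eps Heps.
  assert (Hlim : is_filter_lim (locally x) x) by (intros P HP; exact HP).
  assert (He : 0 < eps / 2) by lra.
  destruct (Hf x Hlim (mkposreal _ He)) as [d1 Hd1].
  destruct (Hg x Hlim (mkposreal _ He)) as [d2 Hd2].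
  exists (Rmin d1 d2).
  split; [apply Rmin_pos; apply cond_pos|].
  intros y Hy Hyx.
  specialize (Hd1 y (Rlt_le_trans _ _ _ Hyx (Rmin_l _ _))).
  specialize (Hd2 y (Rlt_le_trans _ _ _ Hyx (Rmin_r _ _))).
  change (Rabs (f y - f x - (y - x) * l) <= eps / 2 * Rabs (y - x)) in Hd1.
  change (Rabs (g y - g x - (y - x) * m) <= eps / 2 * Rabs (y - x)) in Hd2.
  eapply Rle_trans; [apply Cmod_le_sum|].
  replace (fst ((f y, g y) - (f x, g x) - RtoC (y - x) * (l, m))%C)
    with (f y - f x - (y - x) * l) by (simpl; ring).
  replace (snd ((f y, g y) - (f x, g x) - RtoC (y - x) * (l, m))%C)
    with (g y - g x - (y - x) * m) by (simpl; ring).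
  lra.
Qed.

Lemma is_derive_continuity_pt (g : R -> R) (x l : R) :
  is_derive g x l -> continuity_pt g x.
Proof.
  intros H. apply derivable_continuous_pt. exists l. now apply is_derive_Reals.
Qed.

(** There is no mean value theorem for complex functions, but the real one applies
    to the component of [f] along [f b], which already carries all of
    [Cmod (f b)]. *)
Lemma mean_value_half (f l : R -> C) (g g' : R -> R) (b : R) : 0 <= b ->
  (forall y, 0 <= y <= b -> is_derive_half f y (l y)) ->
  (forall y, 0 <= y <= b -> is_derive g y (g' y)) ->
  (forall y, 0 <= y <= b -> Cmod (l y) <= g' y) ->
  Cmod (f 0) <= g 0 -> Cmod (f b) <= g b.
Proof.
  intros Hb Hf Hg Hl H0.
  destruct (Req_dec b 0) as [->|Hb0]; auto.
  destruct (Ceq_dec (f b) 0) as [Hz|Hz].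
  { rewrite Hz, Cmod_0.
    destruct (MVT_gen g 0 b g') as [c [Hc Heq]].
    - rewrite Rmin_left, Rmax_right by lra. intros; apply Hg; lra.
    - rewrite Rmin_left, Rmax_right by lra. intros x Hx.
      apply (is_derive_continuity_pt _ _ _ (Hg x Hx)).
    - rewrite Rmin_left, Rmax_right in Hc by lra.
      pose proof (Hl c Hc). pose proof (Cmod_ge_0 (l c)).
      pose proof (Cmod_ge_0 (f 0)). nra. }
  set (w := (Cconj (f b) / RtoC (Cmod (f b)))%C).
  assert (Hm : 0 < Cmod (f b)) by now apply Cmod_gt_0.
  assert (Hw : Cmod w = 1).
  { unfold w. rewrite Cmod_div by (intros E; apply RtoC_inj in E; lra).
    rewrite Cmod_conj, Cmod_R, Rabs_pos_eq by lra. field; lra. }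
  (* [f] is frozen for negative arguments to make [phi] continuous on both sides
     of 0. *)
  set (phi := fun y => fst (w * f (Rmax 0 y))%C - g y).
  assert (Hder : forall y, 0 < y <= b ->
    is_derive phi y (fst (w * l y)%C - g' y)).
  { intros y Hy. unfold phi.
    apply (is_derive_minus (K:=R_AbsRing) (fun y => fst (w * f (Rmax 0 y))%C) g).
    2: apply Hg; lra.
    split; [apply is_linear_scal_l|].
    intros x' Hx'.
    assert (Hxy : y = x') by exact (is_filter_lim_locally_unique
      (K:=R_AbsRing) (V:=R_NormedModule) y x' Hx').
    subst x'.
    intros eps.
    pose proof (Hf y ltac:(lra)) as H. rewrite is_derive_half_eps in H by lra.
    destruct (H eps (cond_pos eps)) as [d [Hd0 Hd]].
    assert (Hdy : 0 < Rmin d y) by (apply Rmin_pos; lra).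
    exists (mkposreal _ Hdy). intros x Hx.
    change (Rabs (x - y) < Rmin d y) in Hx.
    assert (Hx1 : Rabs (x - y) < d)
      by (eapply Rlt_le_trans; [exact Hx | apply Rmin_l]).
    assert (Hx2 : Rabs (x - y) < y)
      by (eapply Rlt_le_trans; [exact Hx | apply Rmin_r]).
    assert (Hx0 : 0 <= x) by (apply Rabs_lt_between in Hx2; lra).
    specialize (Hd x Hx0 Hx1).
    change (Rabs (fst (w * f (Rmax 0 x))%C - fst (w * f (Rmax 0 y))%C
        - (x - y) * fst (w * l y)%C) <= eps * Rabs (x - y)).
    rewrite !Rmax_right by lra.
    replace (fst (w * f x)%C - fst (w * f y)%C - (x - y) * fst (w * l y)%C)
      with (fst (w * (f x - f y - RtoC (x - y) * l y))%C) by (simpl; ring).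
    eapply Rle_trans; [|exact Hd].
    rewrite <- (Rmult_1_l (Cmod _)), <- Hw, <- Cmod_mult.
    eapply Rle_trans; [|apply Rmax_Cmod]. apply Rmax_l. }
  assert (Hle : phi b <= phi 0).
  { destruct (MVT_gen phi 0 b (fun y => fst (w * l y)%C - g' y)) as [c [Hc Heq]].
    - rewrite Rmin_left, Rmax_right by lra. intros; apply Hder; lra.
    - rewrite Rmin_left, Rmax_right by lra. intros x Hx.
      destruct (Req_dec x 0) as [->|Hx0].
      2: refine (is_derive_continuity_pt _ _ _ (Hder x _)); lra.
      unfold phi.
      apply (continuity_pt_minus (fun y => fst (w * f (Rmax 0 y))%C) g).
      2: refine (is_derive_continuity_pt _ _ _ (Hg 0 _)); lra.
      apply continuity_pt_filterlim, filterlim_locally. intros eps.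
      pose proof (Hf 0 ltac:(lra)) as H. rewrite is_derive_half_eps in H by lra.
      destruct (H 1 Rlt_0_1) as [d [Hd0 Hd]].
      set (L := 1 + Cmod (l 0)).
      assert (HL : 0 < L) by (unfold L; pose proof (Cmod_ge_0 (l 0)); lra).
      assert (Hdd : 0 < Rmin d (eps / L))
        by (apply Rmin_pos; auto; apply Rdiv_lt_0_compat; [apply cond_pos|auto]).
      exists (mkposreal _ Hdd). intros y Hy.
      change (Rabs (y - 0) < Rmin d (eps / L)) in Hy.
      change (Rabs (fst (w * f (Rmax 0 y))%C - fst (w * f (Rmax 0 0))%C) < eps).
      rewrite (Rmax_left 0 0) by lra.
      assert (Hm' : Rabs (Rmax 0 y - 0) <= Rabs (y - 0)).
      { unfold Rmax; destruct (Rle_dec 0 y); [lra|].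
        rewrite Rminus_diag, Rabs_R0. apply Rabs_pos. }
      assert (Hy' : Rabs (Rmax 0 y - 0) < Rmin d (eps / L)) by lra.
      pose proof (Rmax_l 0 y) as Hp.
      set (y' := Rmax 0 y) in *.
      specialize (Hd y' Hp (Rlt_le_trans _ _ _ Hy' (Rmin_l _ _))).
      assert (Hy2 : Rabs (y' - 0) < eps / L)
        by (eapply Rlt_le_trans; [exact Hy' | apply Rmin_r]).
      replace (fst (w * f y')%C - fst (w * f 0)%C)
        with (fst (w * ((f y' - f 0 - RtoC (y' - 0) * l 0)
                        + RtoC (y' - 0) * l 0))%C) by (simpl; ring).
      apply Rle_lt_trans with (L * Rabs (y' - 0)).
      + eapply Rle_trans; [eapply Rle_trans; [|apply Rmax_Cmod]; apply Rmax_l|].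
        rewrite Cmod_mult, Hw, Rmult_1_l.
        eapply Rle_trans; [apply Cmod_triangle|].
        rewrite Cmod_mult, Cmod_R. unfold L. lra.
      + apply Rmult_lt_compat_l with (r := L) in Hy2; auto.
        replace (L * (eps / L)) with (pos eps) in Hy2 by (field; lra). exact Hy2.
    - rewrite Rmin_left, Rmax_right in Hc by lra.
      assert (fst (w * l c)%C <= g' c).
      { eapply Rle_trans; [apply re_le_Cmod|].
        rewrite Cmod_mult, Hw, Rmult_1_l. apply Hl; lra. }
      nra. }
  unfold phi in Hle. rewrite (Rmax_left 0 0), (Rmax_right 0 b) in Hle by lra.
  assert (Hwb : fst (w * f b)%C = Cmod (f b)).
  { unfold w. replace (Cconj (f b) / RtoC (Cmod (f b)) * f b)%C
      with (f b * Cconj (f b) / RtoC (Cmod (f b)))%C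
      by (field; intros E; apply RtoC_inj in E; lra).
    rewrite <- Cmod2_conj. simpl. field. lra. }
  assert (fst (w * f 0)%C <= Cmod (f 0)).
  { eapply Rle_trans; [apply re_le_Cmod|].
    rewrite Cmod_mult, Hw. lra. }
  lra.
Qed.

(** * Uniqueness for the Goursat problem *)

(** The compactness lemma yields a point near [(t, z)] whose radius is bounded
    below by one [d] valid everywhere.  Making the radius at each point at most
    [1 / (1 + |f|)] there turns that lower bound on radii into an upper bound
    on [|f|]. *)
Lemma bounded_on_rectangle (f : R -> R -> C) (T Z : R) :
  continuous_on_quadrant f -> 0 <= T -> 0 <= Z ->
  exists M, 0 <= M /\
    forall t z, 0 <= t <= T -> 0 <= z <= Z -> Cmod (f t z) <= M.
Proof.
  intros Hf HT HZ.
  assert (Hloc : forall t z, exists d : posreal, 0 <= t -> 0 <= z ->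
    d <= / (1 + Cmod (f t z)) /\
    forall t' z', 0 <= t' -> 0 <= z' -> Rabs (t' - t) < d -> Rabs (z' - z) < d ->
      Cmod (f t' z') <= Cmod (f t z) + 2).
  { intros t z.
    assert (Hi : 0 < / (1 + Cmod (f t z)))
      by (apply Rinv_0_lt_compat; pose proof (Cmod_ge_0 (f t z)); lra).
    destruct (Rle_dec 0 t) as [Ht|Ht]; [|exists (mkposreal 1 Rlt_0_1); lra].
    destruct (Rle_dec 0 z) as [Hz|Hz]; [|exists (mkposreal 1 Rlt_0_1); lra].
    pose proof (Hf (t, z) (conj Ht Hz)) as H.
    destruct (proj1 (filterlim_locally (F:=within quadrant (locally (t, z)))
      (U:=C_UniformSpace) (fun q : R * R => f (fst q) (snd q)) (f t z)) H
      (mkposreal 1 Rlt_0_1)) as [d Hd].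
    assert (Hmin : 0 < Rmin d (/ (1 + Cmod (f t z))))
      by (apply Rmin_pos; auto; apply cond_pos).
    exists (mkposreal _ Hmin). intros _ _. split; [apply Rmin_r|].
    simpl. intros t' z' Ht' Hz' Htt Hzz.
    assert (Hb : ball (f t z) 1 (f t' z')).
    { apply (Hd (t', z')); [|split; assumption].
      split; eapply Rlt_le_trans; [exact Htt | apply Rmin_l
        | exact Hzz | apply Rmin_l]. }
    replace (f t' z') with (f t z + (f t' z' - f t z))%C by ring.
    eapply Rle_trans; [apply Cmod_triangle|]. apply Rplus_le_compat_l.
    eapply Rle_trans; [apply Cmod_le_sum|].
    destruct Hb as [Hb1 Hb2].
    change (Rabs (fst (f t' z') - fst (f t z)) < 1) in Hb1.
    change (Rabs (snd (f t' z') - snd (f t z)) < 1) in Hb2.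
    change (Rabs (fst (f t' z') - fst (f t z)) + Rabs (snd (f t' z') - snd (f t z)) <= 2).
    lra. }
  set (delta := fun t z =>
    proj1_sig (constructive_indefinite_description _ (Hloc t z))).
  destruct (compactness_value_2d 0 T 0 Z delta) as [d Hd].
  assert (Hdp : 0 < / d) by apply Rinv_0_lt_compat, cond_pos.
  exists (/ d + 2). split; [lra|]. intros t z Ht Hz.
  apply Rnot_lt_le. intros Habs.
  apply (Hd t z Ht Hz). intros (t1 & z1 & Ht1 & Hz1 & H1 & H2 & H3).
  unfold delta in *. destruct constructive_indefinite_description as [e He].
  simpl in *. destruct (He ltac:(lra) ltac:(lra)) as [He1 He2].
  specialize (He2 t z ltac:(lra) ltac:(lra) H1 H2).
  assert (Cmod (f t1 z1) <= / d).
  { pose proof (Cmod_ge_0 (f t1 z1)).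
    assert (1 + Cmod (f t1 z1) <= / d).
    { rewrite <- (Rinv_inv (1 + Cmod (f t1 z1))).
      apply Rinv_le_contravar; [apply cond_pos|lra]. }
    lra. }
  lra.
Qed.

Lemma continuous_on_quadrant_minus (f g : R -> R -> C) :
  continuous_on_quadrant f -> continuous_on_quadrant g ->
  continuous_on_quadrant (fun t z => f t z - g t z)%C.
Proof.
  intros Hf Hg p Hp.
  apply (filterlim_comp_2 (H:=locally (g (fst p) (snd p)))
    (fun q : R * R => f (fst q) (snd q)) (fun q => g (fst q) (snd q))
    Cminus (Hf p Hp) (Hg p Hp)).
  apply (filterlim_comp_2 (F:=filter_prod (locally (f (fst p) (snd p)))
     (locally (g (fst p) (snd p)))) (G:=locally (f (fst p) (snd p)))
     (H:=locally (opp (g (fst p) (snd p)))) fst (fun q => opp (snd q))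
     (plus (G:=C_R_NormedModule))).
  - apply filterlim_fst.
  - eapply filterlim_comp; [apply filterlim_snd|].
    apply (filterlim_opp (V:=C_R_NormedModule)).
  - apply (filterlim_plus (V:=C_R_NormedModule)).
Qed.

(** Integrating [exp (lam (t + z))] in either variable costs a factor [1 / lam],
    so once [lam] dominates the coefficients of the system, solving the equations
    with zero data halves any bound of this shape. *)
Lemma zakharov_zero_contraction (E : C) (k lam M : R) (u v n nt : R -> R -> C)
    (T Z : R) :
  1 + 2 * (k ^ 2 + Cmod E + 2 * k ^ 2 * Cmod E) <= lam -> 0 <= M ->
  (forall t z, 0 <= t -> 0 <= z -> exists uz, is_derive_half (fun y => u t y) z uz /\
      (Ci * uz - RtoC (k ^ 2) * u t z - E * n t z = 0)%C) ->
  (forall t z, 0 <= t -> 0 <= z -> exists vz, is_derive_half (fun y => v t y) z vz /\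
      (Ci * vz + RtoC (k ^ 2) * v t z + Cconj E * n t z = 0)%C) ->
  (forall t z, 0 <= t -> 0 <= z -> is_derive_half (fun s => n s z) t (nt t z)) ->
  (forall t z, 0 <= t -> 0 <= z ->
     exists ntt, is_derive_half (fun s => nt s z) t ntt /\
         (ntt + RtoC (k ^ 2) * n t z
            + RtoC (k ^ 2) * (Cconj E * u t z + E * v t z) = 0)%C) ->
  (forall z, 0 <= z -> nt 0 z = RtoC 0) ->
  (forall z, 0 <= z -> n 0 z = RtoC 0) ->
  (forall t, 0 <= t -> u t 0 = RtoC 0) ->
  (forall t, 0 <= t -> v t 0 = RtoC 0) ->
  (forall t z, 0 <= t <= T -> 0 <= z <= Z ->
    Cmod (u t z) <= M * exp (lam * (t + z)) /\
    Cmod (v t z) <= M * exp (lam * (t + z)) /\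
    Cmod (n t z) <= M * exp (lam * (t + z))) ->
  forall t z, 0 <= t <= T -> 0 <= z <= Z ->
    Cmod (u t z) <= M / 2 * exp (lam * (t + z)) /\
    Cmod (v t z) <= M / 2 * exp (lam * (t + z)) /\
    Cmod (n t z) <= M / 2 * exp (lam * (t + z)).
Proof.
  intros Hlam HM Hu Hv Hn Hnt Hnt0 Hn0 Hu0 Hv0 Hb t z Ht Hz.
  pose proof (Cmod_ge_0 E) as HE.
  pose proof (pow2_ge_0 k) as Hk.
  assert (Hke : 0 <= k ^ 2 * Cmod E) by (apply Rmult_le_pos; assumption).
  assert (Hl1 : k ^ 2 + Cmod E <= lam / 2) by lra.
  assert (Hl2 : k ^ 2 + 2 * k ^ 2 * Cmod E <= lam / 2) by lra.
  assert (Hlp : 1 <= lam) by lra.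
  assert (Hq1 : 0 <= (k ^ 2 + Cmod E) * M <= M * (lam / 2)).
  { split; [apply Rmult_le_pos; lra|]. rewrite (Rmult_comm _ M).
    apply Rmult_le_compat_l; lra. }
  assert (Hmd : forall w, Cmod (Ci * w)%C = Cmod w)
    by (intros w; rewrite Cmod_mult, Cmod_Ci; ring).
  assert (Hgz : forall q y, is_derive (fun y => q / lam * exp (lam * (t + y))) y
            (q * exp (lam * (t + y))))
    by (intros q y; auto_derive; [auto|field; lra]).
  assert (Hgt : forall q y, is_derive (fun y => q / lam * exp (lam * (y + z))) y
            (q * exp (lam * (y + z))))
    by (intros q y; auto_derive; [auto|field; lra]).
  assert (Hhalf : forall q, 0 <= q <= M * (lam / 2) -> forall s,
     q / lam * exp (lam * s) <= M / 2 * exp (lam * s)).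
  { intros q Hq s. apply Rmult_le_compat_r; [left; apply exp_pos|].
    apply Rmult_le_reg_r with lam; [lra|].
    replace (q / lam * lam) with q by (field; lra). lra. }
  assert (Hpos : forall q, 0 <= q -> forall s, 0 <= q / lam * exp (lam * s)).
  { intros q Hq s. apply Rmult_le_pos; [|left; apply exp_pos].
    apply Rdiv_le_0_compat; lra. }
  split; [|split].
  - apply Rle_trans with ((k ^ 2 + Cmod E) * M / lam * exp (lam * (t + z))).
    2: apply Hhalf; exact Hq1.
    apply (mean_value_half (fun y => u t y)
      (fun y => (- Ci * (RtoC (k ^ 2) * u t y + E * n t y))%C)
      (fun y => (k ^ 2 + Cmod E) * M / lam * exp (lam * (t + y)))
      (fun y => (k ^ 2 + Cmod E) * M * exp (lam * (t + y)))).
    + lra.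
    + intros y Hy. destruct (Hu t y) as [uz [Hd He]]; [lra|lra|].
      rewrite <- (Ci_mult_eq uz); auto. rewrite <- He. ring.
    + intros y Hy. apply Hgz.
    + intros y Hy. destruct (Hb t y ltac:(lra) ltac:(lra)) as (B1 & B2 & B3).
      replace (- Ci * (RtoC (k ^ 2) * u t y + E * n t y))%C
        with (Ci * (- (RtoC (k ^ 2) * u t y + E * n t y)))%C by ring.
      rewrite Hmd, Cmod_opp.
      eapply Rle_trans; [apply Cmod_triangle|].
      rewrite !Cmod_mult, Cmod_R, (Rabs_pos_eq _ Hk). nra.
    + rewrite Hu0, Cmod_0 by lra. apply Hpos; lra.
  - apply Rle_trans with ((k ^ 2 + Cmod E) * M / lam * exp (lam * (t + z))).
    2: apply Hhalf; exact Hq1.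
    apply (mean_value_half (fun y => v t y)
      (fun y => (Ci * (RtoC (k ^ 2) * v t y + Cconj E * n t y))%C)
      (fun y => (k ^ 2 + Cmod E) * M / lam * exp (lam * (t + y)))
      (fun y => (k ^ 2 + Cmod E) * M * exp (lam * (t + y)))).
    + lra.
    + intros y Hy. destruct (Hv t y) as [uz [Hd He]]; [lra|lra|].
      replace (Ci * (RtoC (k ^ 2) * v t y + Cconj E * n t y))%C
        with (- Ci * - (RtoC (k ^ 2) * v t y + Cconj E * n t y))%C by ring.
      rewrite <- (Ci_mult_eq uz); auto. rewrite <- He. ring.
    + intros y Hy. apply Hgz.
    + intros y Hy. destruct (Hb t y ltac:(lra) ltac:(lra)) as (B1 & B2 & B3).
      rewrite Hmd.
      eapply Rle_trans; [apply Cmod_triangle|].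
      rewrite !Cmod_mult, Cmod_R, (Rabs_pos_eq _ Hk), Cmod_conj. nra.
    + rewrite Hv0, Cmod_0 by lra. apply Hpos; lra.
  - set (q := (k ^ 2 + 2 * k ^ 2 * Cmod E) * M).
    assert (Hq : 0 <= q) by (unfold q; apply Rmult_le_pos; lra).
    assert (Hntb : forall s, 0 <= s <= T ->
      Cmod (nt s z) <= q / lam * exp (lam * (s + z))).
    { intros s Hs.
      apply (mean_value_half (fun s => nt s z)
        (fun s => (- (RtoC (k ^ 2) * n s z
            + RtoC (k ^ 2) * (Cconj E * u s z + E * v s z)))%C)
        (fun y => q / lam * exp (lam * (y + z)))
        (fun y => q * exp (lam * (y + z)))).
      + lra.
      + intros y Hy. destruct (Hnt y z) as [uz [Hd He]]; [lra|lra|].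
        match goal with |- is_derive_half _ _ ?w => replace w with uz; auto end.
        apply Cminus_eq_0. rewrite <- He. ring.
      + intros y Hy. apply Hgt.
      + intros y Hy. destruct (Hb y z ltac:(lra) ltac:(lra)) as (B1 & B2 & B3).
        rewrite Cmod_opp.
        eapply Rle_trans; [apply Cmod_triangle|].
        rewrite !Cmod_mult, Cmod_R, (Rabs_pos_eq _ Hk).
        pose proof (Cmod_triangle (Cconj E * u y z) (E * v y z)) as B4.
        rewrite !Cmod_mult, Cmod_conj in B4.
        set (e := exp (lam * (y + z))) in *. unfold q.
        assert (Cmod (Cconj E * u y z + E * v y z) <= 2 * Cmod E * (M * e)) by nra.
        nra.
      + rewrite Hnt0, Cmod_0 by lra. apply Hpos; auto. }
    apply Rle_trans with (q / lam / lam * exp (lam * (t + z))).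
    2: { apply Hhalf. split; [apply Rdiv_le_0_compat; lra|].
         apply Rle_div_l; [lra|]. unfold q. 
         assert (M * (lam / 2) <= M * (lam / 2) * lam) by nra.
         nra. }
    apply (mean_value_half (fun s => n s z) (fun s => nt s z)
        (fun y => q / lam / lam * exp (lam * (y + z)))
        (fun y => q / lam * exp (lam * (y + z)))).
    + lra.
    + intros y Hy. apply Hn; lra.
    + intros y Hy. apply Hgt.
    + intros y Hy. apply Hntb; lra.
    + rewrite Hn0, Cmod_0 by lra. apply Hpos. apply Rdiv_le_0_compat; lra.
Qed.

(** The difference of two solutions has zero data; iterating the contraction
    on a rectangle, starting from its maximum there, shows that it vanishes. *)
Lemma zakharov_unique (E : C) (k : R) (u0 v0 : R -> C)
    (u v n u' v' n' : R -> R -> C) :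
  zakharov_solution E k u0 v0 u v n -> zakharov_solution E k u0 v0 u' v' n' ->
  forall t z, 0 <= t -> 0 <= z -> n t z = n' t z.
Proof.
  intros S S' t z Ht Hz.
  destruct S as [Cu Cv Cn Hu Hv [nt [Hn [Hnt Hnt0]]] Hn0 Hu0 Hv0].
  destruct S' as [Cu' Cv' Cn' Hu' Hv' [nt' [Hn' [Hnt' Hnt0']]] Hn0' Hu0' Hv0'].
  set (lam := 1 + 2 * (k ^ 2 + Cmod E + 2 * k ^ 2 * Cmod E)).
  assert (Hlam : 0 < lam).
  { unfold lam. pose proof (pow2_ge_0 k). pose proof (Cmod_ge_0 E). nra. }
  destruct (bounded_on_rectangle _ t z (continuous_on_quadrant_minus _ _ Cu Cu') Ht Hz)
    as [M1 [HM1 B1]].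
  destruct (bounded_on_rectangle _ t z (continuous_on_quadrant_minus _ _ Cv Cv') Ht Hz)
    as [M2 [HM2 B2]].
  destruct (bounded_on_rectangle _ t z (continuous_on_quadrant_minus _ _ Cn Cn') Ht Hz)
    as [M3 [HM3 B3]].
  set (M := M1 + M2 + M3).
  assert (Hit : forall m s y, 0 <= s <= t -> 0 <= y <= z ->
    Cmod (u s y - u' s y)%C <= M * (/ 2) ^ m * exp (lam * (s + y)) /\
    Cmod (v s y - v' s y)%C <= M * (/ 2) ^ m * exp (lam * (s + y)) /\
    Cmod (n s y - n' s y)%C <= M * (/ 2) ^ m * exp (lam * (s + y))).
  { induction m as [|m IH].
    - intros s y Hs Hy. specialize (B1 s y Hs Hy).
      specialize (B2 s y Hs Hy). specialize (B3 s y Hs Hy).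
      assert (1 <= exp (lam * (s + y))).
      { pose proof (exp_ineq1_le (lam * (s + y))).
        assert (0 <= lam * (s + y)) by (apply Rmult_le_pos; lra). lra. }
      unfold M. simpl. repeat split; nra.
    - replace (M * (/ 2) ^ S m) with (M * (/ 2) ^ m / 2) by (simpl; field).
      apply (zakharov_zero_contraction E k lam (M * (/ 2) ^ m)
        (fun t z => u t z - u' t z)%C (fun t z => v t z - v' t z)%C
        (fun t z => n t z - n' t z)%C (fun t z => nt t z - nt' t z)%C t z);
        auto.
      + apply Rle_refl.
      + apply Rmult_le_pos; [unfold M; lra|]. apply pow_le; lra.
      + intros s y Hs Hy. destruct (Hu s y Hs Hy) as [a [Ha Ea]].
        destruct (Hu' s y Hs Hy) as [b [Hb Eb]]. exists (a - b)%C.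
        split; [now apply is_derive_half_minus|].
        transitivity ((Ci * a - RtoC (k ^ 2) * u s y - E * n s y)
          - (Ci * b - RtoC (k ^ 2) * u' s y - E * n' s y))%C; [ring|].
        rewrite Ea, Eb. ring.
      + intros s y Hs Hy. destruct (Hv s y Hs Hy) as [a [Ha Ea]].
        destruct (Hv' s y Hs Hy) as [b [Hb Eb]]. exists (a - b)%C.
        split; [now apply is_derive_half_minus|].
        transitivity ((Ci * a + RtoC (k ^ 2) * v s y + Cconj E * n s y)
          - (Ci * b + RtoC (k ^ 2) * v' s y + Cconj E * n' s y))%C; [ring|].
        rewrite Ea, Eb. ring.
      + intros s y Hs Hy. apply is_derive_half_minus; auto.
      + intros s y Hs Hy. destruct (Hnt s y Hs Hy) as [a [Ha Ea]].
        destruct (Hnt' s y Hs Hy) as [b [Hb Eb]]. exists (a - b)%C.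
        split; [now apply is_derive_half_minus|].
        transitivity ((a + RtoC (k ^ 2) * n s y
            + RtoC (k ^ 2) * (Cconj E * u s y + E * v s y))
          - (b + RtoC (k ^ 2) * n' s y
            + RtoC (k ^ 2) * (Cconj E * u' s y + E * v' s y)))%C; [ring|].
        rewrite Ea, Eb. ring.
      + intros y Hy. rewrite Hnt0, Hnt0' by auto. ring.
      + intros y Hy. rewrite Hn0, Hn0' by auto. ring.
      + intros y Hy. rewrite Hu0, Hu0' by auto. ring.
      + intros y Hy. rewrite Hv0, Hv0' by auto. ring. }
  assert (Hz0 : Cmod (n t z - n' t z)%C <= 0).
  { assert (HL : is_lim_seq (fun m => M * exp (lam * (t + z)) * (/ 2) ^ m)
              (Finite (M * exp (lam * (t + z)) * 0))).
    { apply (is_lim_seq_scal_l _ _ (Finite 0)). apply is_lim_seq_geom.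
      rewrite Rabs_pos_eq; lra. }
    rewrite Rmult_0_r in HL.
    refine (is_lim_seq_le (fun _ => Cmod (n t z - n' t z)%C) _
       (Finite _) (Finite 0) _ (is_lim_seq_const _) HL).
    intros m. destruct (Hit m t z) as (_ & _ & H); [lra|lra|]. lra. }
  assert (H0 : (n t z - n' t z)%C = 0).
  { apply Cmod_eq_0. pose proof (Cmod_ge_0 (n t z - n' t z)%C). lra. }
  replace (n t z) with (n t z - n' t z + n' t z)%C by ring.
  rewrite H0. ring.
Qed.

(** * Resonantly forced oscillators *)

(** Stepping down the index with value 0 below index 0 lets the recursions hold
    for [j = 0] as well. *)
Definition shift (P : nat -> R -> C) (j : nat) (x : R) : C :=
  match j with O => 0 | S i => P i x end.

(** [osc j] solves [F'' + F = osc (j - 1)] from rest, starting from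
    [osc 0 x = exp (i x)].  Up to normalization its real and imaginary parts are
    the spherical Bessel functions of orders [j - 1] and [j] times [x^(j+1)],
    and the recursion below is their three-term recurrence, written so
    that no division by [x] occurs. *)
Fixpoint osc (j : nat) (x : R) : C :=
  match j with
  | O => (cos x, sin x)
  | S i => (x * snd (osc i x) / (2 * (INR i + 1)),
            ((2 * INR i + 1) * snd (osc i x) - x * fst (osc i x))
              / (2 * (INR i + 1)))
  end.

Definition prev_im (j : nat) (x : R) : R := snd (shift osc j x).

(** The invariant of the recursion that makes the differential equations of
    [is_derive_osc] pass from [j] to [j + 1]. *)
Lemma osc_fst (j : nat) (x : R) :
  2 * INR j * fst (osc j x) = x * prev_im j x.
Proof.
  unfold prev_im. destruct j as [|i]; [simpl; ring|].
  pose proof (pos_INR i). rewrite S_INR. simpl shift. simpl osc. cbn [fst snd]. field. lra.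
Qed.

(** With [F = osc j], this is [F' = i F + Im (osc (j - 1))]. *)
Lemma is_derive_osc (j : nat) : forall x : R,
  is_derive (fun x => fst (osc j x)) x (prev_im j x - snd (osc j x)) /\
  is_derive (fun x => snd (osc j x)) x (fst (osc j x)).
Proof.
  induction j as [|i IH]; intros x.
  - simpl. unfold prev_im. simpl. split; auto_derive; auto; ring.
  - destruct (IH x) as [H1 H2]. pose proof (osc_fst i x) as Hr.
    pose proof (pos_INR i) as Hi.
    assert (D1 : ex_derive (fun x => fst (osc i x)) x) by (eexists; eassumption).
    assert (D2 : ex_derive (fun x => snd (osc i x)) x) by (eexists; eassumption).
    unfold prev_im at 1. simpl shift. simpl osc.
    cbn [fst snd].
    set (f := fun x => fst (osc i x)) in *. set (g := fun x => snd (osc i x)) in *.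
    change (snd (osc i x)) with (g x) in *. change (fst (osc i x)) with (f x) in *.
    assert (E1 : Derive (fun y : R => f y) x = prev_im i x - g x)
      by (apply is_derive_unique; exact H1).
    assert (E2 : Derive (fun y : R => g y) x = f x)
      by (apply is_derive_unique; exact H2).
    split.
    + apply (is_derive_ext (fun x => x * g x / (2 * (INR i + 1)))).
      { reflexivity. }
      auto_derive; auto. rewrite E2. field. lra.
    + apply (is_derive_ext
        (fun x => ((2 * INR i + 1) * g x - x * f x) / (2 * (INR i + 1)))).
      { reflexivity. }
      auto_derive; auto. rewrite E1, E2.
      apply Rmult_eq_reg_r with (2 * (INR i + 1)); [|lra].
      field_simplify; [|lra|lra]. lra.
Qed.

Lemma osc_0 (j : nat) : snd (osc j 0) = 0 /\ (j <> O -> fst (osc j 0) = 0).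
Proof.
  induction j as [|i [IH _]]; simpl.
  - split; [apply sin_0 | congruence].
  - rewrite IH. pose proof (pos_INR i). split; intros; field; lra.
Qed.

Lemma is_derive_pow_fact (i : nat) (y : R) :
  is_derive (fun y => y ^ S i / INR (fact (S i))) y (y ^ i / INR (fact i)).
Proof.
  pose proof (INR_fact_lt_0 i). pose proof (pos_INR i).
  auto_derive; auto. rewrite <- ?plus_n_O.
  change (fact i + i * fact i)%nat with (fact (S i)).
  rewrite fact_simpl, mult_INR, !S_INR. 
  simpl pred. destruct i; simpl; field; simpl in *; lra.
Qed.

(** In the rotating frame only the forcing is left:
    [(exp (- i x) F_j)' = exp (- i x) Im F_(j-1)].  Integrating [j] times gives
    the factorial, which the recursion defining [osc] does not show. *)
Lemma Cmod_osc_le (j : nat) : forall x : R, 0 <= x ->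
  Cmod (osc j x) <= x ^ j / INR (fact j).
Proof.
  induction j as [|i IH]; intros x Hx.
  - simpl. unfold Cmod. cbn [fst snd].
    replace (cos x ^ 2 + sin x ^ 2) with 1
      by (pose proof (sin2_cos2 x); unfold Rsqr in *; lra).
    rewrite sqrt_1. lra.
  - set (F := fun y => (cos y * fst (osc (S i) y) + sin y * snd (osc (S i) y),
                        cos y * snd (osc (S i) y) - sin y * fst (osc (S i) y)) : C).
    assert (HF : Cmod (F x) = Cmod (osc (S i) x)).
    { unfold F, Cmod. cbn [fst snd]. f_equal.
      pose proof (sin2_cos2 x) as Hsc. unfold Rsqr in Hsc.
      set (a := fst _). set (b := snd _).
      replace (a ^ 2 + b ^ 2)
        with ((sin x * sin x + cos x * cos x) * (a ^ 2 + b ^ 2)) by (rewrite Hsc; ring).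
      ring. }
    rewrite <- HF.
    apply (mean_value_half F
      (fun y => (cos y * snd (osc i y), - sin y * snd (osc i y)))
      (fun y => y ^ S i / INR (fact (S i))) (fun y => y ^ i / INR (fact i))); auto.
    + intros y Hy. destruct (is_derive_osc (S i) y) as [H1 H2].
      unfold prev_im, shift in H1.
      set (f := fun x => fst (osc (S i) x)) in *.
      set (g := fun x => snd (osc (S i) x)) in *.
      assert (D1 : ex_derive f y) by (eexists; exact H1).
      assert (D2 : ex_derive g y) by (eexists; exact H2).
      assert (E1 : Derive (fun y => f y) y = snd (osc i y) - g y)
        by (apply is_derive_unique; exact H1).
      assert (E2 : Derive (fun y => g y) y = f y)
        by (apply is_derive_unique; exact H2).
      apply (is_derive_half_pair
        (fun y => cos y * f y + sin y * g y) (fun y => cos y * g y - sin y * f y));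
        [lra| |]; auto_derive; auto; rewrite E1, E2; ring.
    + intros y Hy. apply is_derive_pow_fact.
    + intros y Hy. eapply Rle_trans; [|apply IH; lra].
      eapply Rle_trans; [|apply (Rle_trans _ _ _ (Rmax_r _ _) (Rmax_Cmod _))].
      right. unfold Cmod. cbn [fst snd]. rewrite <- sqrt_Rsqr_abs. f_equal.
      pose proof (sin2_cos2 y) as Hsc. unfold Rsqr in *.
      set (a := snd _).
      replace (a * a) with ((sin y * sin y + cos y * cos y) * (a * a))
        by (rewrite Hsc; ring). ring.
    + unfold F. destruct (osc_0 (S i)) as [H1 H2]. rewrite H1, H2 by discriminate.
      rewrite !Rmult_0_r, Rplus_0_l, Rminus_0_r.
      change (0, 0) with (RtoC 0). rewrite Cmod_0.
      pose proof (INR_fact_lt_0 (S i)). rewrite pow_i by lia. lra.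
Qed.

Lemma pow_fact_le_exp (x : R) (j : nat) : 0 <= x -> x ^ j / INR (fact j) <= exp x.
Proof.
  intros Hx. eapply Rle_trans; [|apply (exp_ge_taylor x j Hx)].
  destruct j as [|j]; [simpl; lra|]. rewrite tech5.
  assert (0 <= sum_f_R0 (fun k => x ^ k / INR (fact k)) j).
  { apply cond_pos_sum. intros k. apply Rdiv_le_0_compat; [now apply pow_le|].
    apply INR_fact_lt_0. }
  lra.
Qed.

(** A form with the same constant for [x < y] and [y < x]; the factor [1/2] of
    the Taylor remainder is dropped. *)
Lemma taylor2 (g g1 g2 : R -> R) (B K : R) :
  (forall x, is_derive g x (g1 x)) -> (forall x, is_derive g1 x (g2 x)) ->
  (forall x, 0 <= x <= B -> Rabs (g2 x) <= K) ->
  forall x y, 0 <= x <= B -> 0 <= y <= B ->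
    Rabs (g y - g x - (y - x) * g1 x) <= K * (y - x) ^ 2.
Proof.
  intros H1 H2 HK x y Hx Hy.
  destruct (MVT_gen g x y g1) as [c [Hc Ec]].
  { auto. } { intros; eapply is_derive_continuity_pt; apply H1. }
  destruct (MVT_gen g1 x c g2) as [d [Hd Ed]].
  { auto. } { intros; eapply is_derive_continuity_pt; apply H2. }
  assert (Hcx : Rabs (c - x) <= Rabs (y - x)).
  { revert Hc. unfold Rmin, Rmax.
    destruct (Rle_dec x y); intros; split_Rabs; lra. }
  assert (Hd' : 0 <= d <= B).
  { revert Hc Hd. unfold Rmin, Rmax.
    destruct (Rle_dec x y), (Rle_dec x c); lra. }
  replace (g y - g x - (y - x) * g1 x) with ((g1 c - g1 x) * (y - x))
    by (rewrite Ec; ring).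
  rewrite Ed, !Rabs_mult. specialize (HK d Hd').
  rewrite <- (pow2_abs (y - x)).
  pose proof (Rabs_pos (y - x)). pose proof (Rabs_pos (c - x)).
  pose proof (Rabs_pos (g2 d)).
  assert (Rabs (g2 d) * Rabs (c - x) <= K * Rabs (y - x))
    by (apply Rmult_le_compat; auto).
  nra.
Qed.

(** Decay in [j] faster than every geometric sequence, locally uniformly in
    [x >= 0].  Unlike a factorial bound this is stable under index shifts. *)
Definition rapid (P : nat -> R -> C) : Prop :=
  forall B r, 0 <= B -> 0 < r -> exists K, 0 <= K /\
    forall j x, 0 <= x <= B -> Cmod (P j x) <= K * r ^ j.

(** [P' j] is the derivative of [P j], with a quadratic remainder that is itself
    rapidly decreasing: exactly what differentiation under the sum needs. *)
Definition rapid_derive (P P' : nat -> R -> C) : Prop :=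
  forall B r, 0 <= B -> 0 < r -> exists K, 0 <= K /\
    forall j x y, 0 <= x <= B -> 0 <= y <= B ->
      Cmod (P j y - P j x - RtoC (y - x) * P' j x)%C <= K * r ^ j * (y - x) ^ 2.

Definition lin (a : C) (P Q : nat -> R -> C) (j : nat) (x : R) : C :=
  (a * P j x + Q j x)%C.
Definition conj_seq (P : nat -> R -> C) (j : nat) (x : R) : C := Cconj (P j x).

Lemma rapid_lin a (P Q : nat -> R -> C) : rapid P -> rapid Q -> rapid (lin a P Q).
Proof.
  intros HP HQ B r HB Hr.
  destruct (HP B r HB Hr) as [K1 [HK1 H1]]. destruct (HQ B r HB Hr) as [K2 [HK2 H2]].
  pose proof (Cmod_ge_0 a).
  exists (Cmod a * K1 + K2). split; [nra|]. intros j x Hx. unfold lin.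
  eapply Rle_trans; [apply Cmod_triangle|]. rewrite Cmod_mult.
  specialize (H1 j x Hx). specialize (H2 j x Hx). nra.
Qed.

Lemma rapid_derive_lin a (P Q P' Q' : nat -> R -> C) : rapid_derive P P' -> rapid_derive Q Q' ->
  rapid_derive (lin a P Q) (lin a P' Q').
Proof.
  intros HP HQ B r HB Hr.
  destruct (HP B r HB Hr) as [K1 [HK1 H1]]. destruct (HQ B r HB Hr) as [K2 [HK2 H2]].
  pose proof (Cmod_ge_0 a).
  exists (Cmod a * K1 + K2). split; [nra|]. intros j x y Hx Hy. unfold lin.
  replace (a * P j y + Q j y - (a * P j x + Q j x)
     - RtoC (y - x) * (a * P' j x + Q' j x))%C
    with (a * (P j y - P j x - RtoC (y - x) * P' j x)
     + (Q j y - Q j x - RtoC (y - x) * Q' j x))%C by ring.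
  eapply Rle_trans; [apply Cmod_triangle|]. rewrite Cmod_mult.
  specialize (H1 j x y Hx Hy). specialize (H2 j x y Hx Hy). nra.
Qed.

Lemma rapid_conj (P : nat -> R -> C) : rapid P -> rapid (conj_seq P).
Proof.
  intros HP B r HB Hr. destruct (HP B r HB Hr) as [K1 [HK1 H1]].
  exists K1. split; auto. intros. unfold conj_seq. rewrite Cmod_conj. auto.
Qed.

Lemma rapid_derive_conj (P P' : nat -> R -> C) :
  rapid_derive P P' -> rapid_derive (conj_seq P) (conj_seq P').
Proof.
  intros HP B r HB Hr. destruct (HP B r HB Hr) as [K1 [HK1 H1]].
  exists K1. split; auto. intros j x y Hx Hy. unfold conj_seq.
  rewrite <- (Cmod_conj). rewrite !Cminus_conj, Cmult_conj, !Cconj_conj.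
  replace (Cconj (RtoC (y - x))) with (RtoC (y - x))
    by (apply injective_projections; simpl; ring).
  auto.
Qed.

Lemma rapid_shift (P : nat -> R -> C) : rapid P -> rapid (shift P).
Proof.
  intros HP B r HB Hr. destruct (HP B r HB Hr) as [K1 [HK1 H1]].
  exists (K1 / r). split; [now apply Rdiv_le_0_compat|]. intros [|j] x Hx; simpl.
  - rewrite Cmod_0. rewrite Rmult_1_r. now apply Rdiv_le_0_compat.
  - replace (K1 / r * (r * r ^ j)) with (K1 * r ^ j) by (field; lra). auto.
Qed.

Lemma rapid_derive_shift (P P' : nat -> R -> C) :
  rapid_derive P P' -> rapid_derive (shift P) (shift P').
Proof.
  intros HP B r HB Hr. destruct (HP B r HB Hr) as [K1 [HK1 H1]].
  exists (K1 / r). split; [now apply Rdiv_le_0_compat|].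
  intros [|j] x y Hx Hy; cbn [shift].
  - replace (0 - 0 - RtoC (y - x) * 0)%C with (RtoC 0) by ring. rewrite Cmod_0.
    assert (0 <= K1 / r) by now apply Rdiv_le_0_compat.
    simpl. pose proof (pow2_ge_0 (y - x)). simpl in *. nra.
  - replace (K1 / r * r ^ S j) with (K1 * r ^ j) by (simpl; field; lra). auto.
Qed.

Lemma rapid_succ (P : nat -> R -> C) : rapid P -> rapid (fun j => P (S j)).
Proof.
  intros HP B r HB Hr. destruct (HP B r HB Hr) as [K1 [HK1 H1]].
  exists (K1 * r). split; [nra|]. intros j x Hx.
  replace (K1 * r * r ^ j) with (K1 * r ^ S j) by (simpl; ring). auto.
Qed.

Lemma rapid_derive_succ (P P' : nat -> R -> C) :
  rapid_derive P P' -> rapid_derive (fun j => P (S j)) (fun j => P' (S j)).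
Proof.
  intros HP B r HB Hr. destruct (HP B r HB Hr) as [K1 [HK1 H1]].
  exists (K1 * r). split; [nra|]. intros j x y Hx Hy.
  replace (K1 * r * r ^ j) with (K1 * r ^ S j) by (simpl; ring). auto.
Qed.

Definition im_seq (P : nat -> R -> C) (j : nat) (x : R) : C := RtoC (snd (P j x)).
Definition zero_seq (j : nat) (x : R) : C := 0.

Lemma Cmod_im_le (z : C) : Cmod (RtoC (snd z)) <= Cmod z.
Proof.
  rewrite Cmod_R. eapply Rle_trans; [|apply Rmax_Cmod]. apply Rmax_r.
Qed.

Lemma rapid_im (P : nat -> R -> C) : rapid P -> rapid (im_seq P).
Proof.
  intros HP B r HB Hr. destruct (HP B r HB Hr) as [K1 [HK1 H1]].
  exists K1. split; auto. intros j x Hx.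
  eapply Rle_trans; [apply Cmod_im_le|auto].
Qed.

Lemma rapid_derive_im (P P' : nat -> R -> C) :
  rapid_derive P P' -> rapid_derive (im_seq P) (im_seq P').
Proof.
  intros HP B r HB Hr. destruct (HP B r HB Hr) as [K1 [HK1 H1]].
  exists K1. split; auto. intros j x y Hx Hy. unfold im_seq.
  eapply Rle_trans; [|apply (H1 j x y Hx Hy)].
  eapply Rle_trans; [|apply Cmod_im_le].
  right. f_equal. apply injective_projections; simpl; ring.
Qed.

Lemma rapid_zero : rapid zero_seq.
Proof.
  intros B r HB Hr. exists 0. split; [lra|]. intros. unfold zero_seq.
  rewrite Cmod_0. lra.
Qed.

Lemma rapid_derive_zero : rapid_derive zero_seq zero_seq.
Proof.
  intros B r HB Hr. exists 0. split; [lra|]. intros. unfold zero_seq.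
  replace (0 - 0 - RtoC (y - x) * 0)%C with (RtoC 0) by ring.
  rewrite Cmod_0. lra.
Qed.

(** [B^j / j! <= exp (B / r) * r^j]. *)
Lemma rapid_osc : rapid osc.
Proof.
  intros B r HB Hr. exists (exp (B / r)). split; [left; apply exp_pos|].
  intros j x Hx. eapply Rle_trans; [apply Cmod_osc_le; lra|].
  pose proof (INR_fact_lt_0 j). pose proof (pow_lt r j Hr).
  assert (HBr : 0 <= B / r) by now apply Rdiv_le_0_compat.
  pose proof (pow_fact_le_exp (B / r) j HBr).
  apply Rle_trans with ((B / r) ^ j / INR (fact j) * r ^ j).
  - replace ((B / r) ^ j / INR (fact j) * r ^ j) with (B ^ j / INR (fact j)).
    + apply Rmult_le_compat_r; [left; now apply Rinv_0_lt_compat|].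
      apply pow_incr. lra.
    + unfold Rdiv at 3. rewrite Rpow_mult_distr, pow_inv. field. lra.
  - apply Rmult_le_compat_r; lra.
Qed.

Definition prev : nat -> R -> C := im_seq (shift osc).
Definition osc' : nat -> R -> C := lin Ci osc prev.

Lemma rapid_derive_osc : rapid_derive osc osc'.
Proof.
  intros B r HB Hr.
  destruct (rapid_osc B r HB Hr) as [K1 [HK1 H1]].
  destruct (rapid_shift _ rapid_osc B r HB Hr) as [K2 [HK2 H2]].
  exists (2 * (K1 + K2)). split; [lra|]. intros j x y Hx Hy.
  pose proof (pow_lt r j Hr) as Hrj.
  assert (Hb1 : forall x, 0 <= x <= B ->
     Rabs (fst (osc j x)) <= K1 * r ^ j /\ Rabs (snd (osc j x)) <= K1 * r ^ j).
  { intros w Hw. split; (eapply Rle_trans; [|apply (H1 j w Hw)]);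
    (eapply Rle_trans; [|apply Rmax_Cmod]); [apply Rmax_l|apply Rmax_r]. }
  assert (Hb2 : forall x, 0 <= x <= B ->
     Rabs (fst (shift osc j x)) <= K2 * r ^ j /\
     Rabs (snd (shift osc j x)) <= K2 * r ^ j).
  { intros w Hw. split; (eapply Rle_trans; [|apply (H2 j w Hw)]);
    (eapply Rle_trans; [|apply Rmax_Cmod]); [apply Rmax_l|apply Rmax_r]. }
  assert (Hp : forall x, is_derive (prev_im j) x (fst (shift osc j x))).
  { intros w. destruct j as [|i]; unfold prev_im; simpl.
    - apply (is_derive_const (K:=R_AbsRing) (V:=R_NormedModule) 0 w).
    - apply is_derive_osc. }
  pose proof (taylor2 (fun x => fst (osc j x))
    (fun x => prev_im j x - snd (osc j x))
    (fun x => fst (shift osc j x) - fst (osc j x)) B ((K1 + K2) * r ^ j)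
    (fun x => proj1 (is_derive_osc j x))
    (fun x => is_derive_minus (K:=R_AbsRing) (V:=R_NormedModule) _ _ _ _ _
                (Hp x) (proj2 (is_derive_osc j x)))) as T1.
  pose proof (taylor2 (fun x => snd (osc j x)) (fun x => fst (osc j x))
    (fun x => prev_im j x - snd (osc j x)) B ((K1 + K2) * r ^ j)
    (fun x => proj2 (is_derive_osc j x))
    (fun x => proj1 (is_derive_osc j x))) as T2.
  specialize (T1 ltac:(intros w Hw; destruct (Hb1 w Hw), (Hb2 w Hw);
     eapply Rle_trans; [apply Rabs_triang|]; rewrite Rabs_Ropp; lra) x y Hx Hy).
  specialize (T2 ltac:(intros w Hw; destruct (Hb1 w Hw), (Hb2 w Hw); unfold prev_im;
     eapply Rle_trans; [apply Rabs_triang|]; rewrite Rabs_Ropp; lra) x y Hx Hy).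
  eapply Rle_trans; [apply Cmod_le_sum|].
  replace (fst (osc j y - osc j x - RtoC (y - x) * osc' j x)%C)
    with (fst (osc j y) - fst (osc j x) - (y - x) * (prev_im j x - snd (osc j x)))
    by (unfold osc', lin, prev, im_seq, prev_im; simpl; ring).
  replace (snd (osc j y - osc j x - RtoC (y - x) * osc' j x)%C)
    with (snd (osc j y) - snd (osc j x) - (y - x) * fst (osc j x))
    by (unfold osc', lin, prev, im_seq, prev_im; simpl; ring).
  lra.
Qed.

(** * Series of products of functions of one variable *)

Definition Csum (f : nat -> C) : C :=
  (Series (fun j => fst (f j)), Series (fun j => snd (f j))).

Definition abs_summable (f : nat -> C) : Prop := ex_series (fun j => Cmod (f j)).

Lemma abs_summable_le (f : nat -> C) (b : nat -> R) :
  (forall j, Cmod (f j) <= b j) -> ex_series b -> abs_summable f.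
Proof.
  intros H Hb. apply (ex_series_le (K:=R_AbsRing) (V:=R_CompleteNormedModule)) with b; auto.
  intros n. change (Rabs (Cmod (f n)) <= b n).
  rewrite Rabs_pos_eq by apply Cmod_ge_0. auto.
Qed.

Lemma ex_series_fst (f : nat -> C) :
  abs_summable f -> ex_series (fun j => fst (f j)).
Proof.
  apply (ex_series_le (K:=R_AbsRing) (V:=R_CompleteNormedModule)).
  intros n. eapply Rle_trans; [|apply Rmax_Cmod]. apply Rmax_l.
Qed.

Lemma ex_series_snd (f : nat -> C) :
  abs_summable f -> ex_series (fun j => snd (f j)).
Proof.
  apply (ex_series_le (K:=R_AbsRing) (V:=R_CompleteNormedModule)).
  intros n. eapply Rle_trans; [|apply Rmax_Cmod]. apply Rmax_r.
Qed.

Lemma Csum_ext (f g : nat -> C) : (forall j, f j = g j) -> Csum f = Csum g.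
Proof.
  intros H. unfold Csum. f_equal; apply Series_ext; intros; now rewrite H.
Qed.

Lemma Csum_lin (a : C) (f g : nat -> C) : abs_summable f -> abs_summable g ->
  Csum (fun j => a * f j + g j)%C = (a * Csum f + Csum g)%C.
Proof.
  intros Hf Hg. pose proof (ex_series_fst f Hf) as F1.
  pose proof (ex_series_snd f Hf) as F2.
  pose proof (ex_series_fst g Hg) as G1. pose proof (ex_series_snd g Hg) as G2.
  assert (sc : forall (c : R) (h : nat -> R), ex_series h -> ex_series (fun j => c * h j)).
  { intros c h. apply (ex_series_scal_l (K:=R_AbsRing) (V:=R_NormedModule) c). }
  unfold Csum. apply injective_projections; simpl.
  - rewrite Series_plus, Series_minus, !Series_scal_l; auto.
    apply (ex_series_minus (V:=R_NormedModule)); now apply sc.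
  - rewrite Series_plus, Series_plus, !Series_scal_l; auto.
    apply (ex_series_plus (V:=R_NormedModule)); now apply sc.
Qed.

Lemma Csum_0 : Csum (fun _ => 0) = 0.
Proof.
  unfold Csum. simpl.
  rewrite (Series_ext _ (fun n => 0 * 0)) by (intros; ring).
  rewrite Series_scal_l, Rmult_0_l. reflexivity.
Qed.

Lemma abs_summable_0 : abs_summable (fun _ => 0).
Proof.
  apply abs_summable_le with (fun j => 0 * (/ 2) ^ j).
  - intros; rewrite Cmod_0; lra.
  - apply (ex_series_scal_l (K:=R_AbsRing) (V:=R_NormedModule) 0).
    apply ex_series_geom. rewrite Rabs_pos_eq; lra.
Qed.

Lemma Csum_scal (a : C) (f : nat -> C) : abs_summable f ->
  Csum (fun j => a * f j)%C = (a * Csum f)%C.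
Proof.
  intros Hf. pose proof (Csum_lin a f (fun _ => 0) Hf abs_summable_0) as H.
  rewrite Csum_0, Cplus_0_r in H. rewrite <- H.
  apply Csum_ext. intros; ring.
Qed.

Lemma Csum_minus (f g : nat -> C) : abs_summable f -> abs_summable g ->
  Csum (fun j => f j - g j)%C = (Csum f - Csum g)%C.
Proof.
  intros Hf Hg.
  rewrite (Csum_ext _ (fun j => (- (1)) * g j + f j)%C) by (intros; ring).
  rewrite Csum_lin by assumption. ring.
Qed.

Lemma Csum_incr_1 (f : nat -> C) : abs_summable f ->
  Csum f = (f O + Csum (fun j => f (S j)))%C.
Proof.
  intros Hf. unfold Csum. apply injective_projections; simpl.
  - apply (Series_incr_1 (fun j => fst (f j))). now apply ex_series_fst.
  - apply (Series_incr_1 (fun j => snd (f j))). now apply ex_series_snd.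
Qed.

Lemma Cmod_Csum_le (f : nat -> C) (b : nat -> R) :
  (forall j, Cmod (f j) <= b j) -> ex_series b -> Cmod (Csum f) <= Series b.
Proof.
  intros H Hb. pose proof (abs_summable_le f b H Hb) as Hf.
  destruct (Ceq_dec (Csum f) 0) as [Hz|Hz].
  { rewrite Hz, Cmod_0. rewrite <- (Rmult_0_l (Series (fun _ => 0))), <- Series_scal_l.
    apply Series_le; auto. intros n. pose proof (Cmod_ge_0 (f n)).
    specialize (H n). lra. }
  assert (Hm : 0 < Cmod (Csum f)) by now apply Cmod_gt_0.
  assert (Hm' : RtoC (Cmod (Csum f)) <> 0) by (intros E; apply RtoC_inj in E; lra).
  set (w := (Cconj (Csum f) / RtoC (Cmod (Csum f)))%C).
  assert (Hw : Cmod w = 1).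
  { unfold w. rewrite Cmod_div, Cmod_conj, Cmod_R, Rabs_pos_eq by (auto; lra).
    field; lra. }
  assert (Hs : Cmod (Csum f) = fst (w * Csum f)%C).
  { unfold w. replace (Cconj (Csum f) / RtoC (Cmod (Csum f)) * Csum f)%C
      with (Csum f * Cconj (Csum f) / RtoC (Cmod (Csum f)))%C by (field; auto).
    rewrite <- Cmod2_conj. simpl. field. lra. }
  rewrite Hs, <- Csum_scal by assumption. unfold Csum at 1. cbn [fst].
  eapply Rle_trans; [apply Rle_abs|].
  assert (Hle : forall n, Rabs (fst (w * f n)%C) <= b n).
  { intros n. eapply Rle_trans; [|apply (H n)].
    rewrite <- (Rmult_1_l (Cmod (f n))), <- Hw, <- Cmod_mult.
    eapply Rle_trans; [|apply Rmax_Cmod]. apply Rmax_l. }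
  assert (Hex : ex_series (fun n => Rabs (fst (w * f n)%C))).
  { apply (ex_series_le (K:=R_AbsRing) (V:=R_CompleteNormedModule)) with b; auto.
    intros n. change (Rabs (Rabs (fst (w * f n)%C)) <= b n). rewrite Rabs_Rabsolu. auto. }
  eapply Rle_trans; [now apply Series_Rabs|].
  apply Series_le; auto. intros n. split; [apply Rabs_pos|auto].
Qed.

(** Solutions by separation of variables have this shape. *)
Definition tensor_series (c : R) (P Q : nat -> R -> C) (x y : R) : C :=
  Csum (fun j => RtoC (c ^ j) * (P j x * Q j y))%C.

Lemma ex_series_half_geom (K : R) : ex_series (fun j => K * (/ 2) ^ j).
Proof.
  apply (ex_series_scal_l (K:=R_AbsRing) (V:=R_NormedModule) K).
  apply ex_series_geom. rewrite Rabs_pos_eq; lra.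
Qed.

Lemma Series_half_geom (K : R) : Series (fun j => K * (/ 2) ^ j) = 2 * K.
Proof.
  rewrite Series_scal_l, Series_geom by (rewrite Rabs_pos_eq; lra). field.
Qed.

(** If [P] decays at rate [r] and [Q] is merely bounded in [j], the terms
    [c^j P_j Q_j] are dominated by a multiple of [2^-j]. *)
Lemma ratio_spec (c : R) : 0 <= c -> exists r, 0 < r /\
  forall j, c ^ j * (r ^ j * 1 ^ j) <= (/ 2) ^ j.
Proof.
  intros Hc. exists (/ (2 * (c + 1))). split.
  { apply Rinv_0_lt_compat; lra. }
  intros j. rewrite pow1, Rmult_1_r, <- Rpow_mult_distr.
  assert (0 < / (2 * (c + 1))) by (apply Rinv_0_lt_compat; lra).
  apply pow_incr. split; [nra|].
  apply Rmult_le_reg_r with (2 * (c + 1)); [lra|].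
  rewrite Rmult_assoc, Rinv_l by lra. lra.
Qed.

Lemma Cmod_pow_nonneg (c : R) (j : nat) : 0 <= c -> Cmod (RtoC (c ^ j)) = c ^ j.
Proof.
  intros. rewrite Cmod_R. apply Rabs_pos_eq. now apply pow_le.
Qed.

Lemma abs_summable_tensor_series (c : R) (P Q : nat -> R -> C) (x y : R) :
  0 <= c -> rapid P -> rapid Q -> 0 <= x -> 0 <= y ->
  abs_summable (fun j => RtoC (c ^ j) * (P j x * Q j y))%C.
Proof.
  intros Hc HP HQ Hx Hy. destruct (ratio_spec c Hc) as [r [Hr Hrj]].
  destruct (HP x r Hx Hr) as [K1 [HK1 H1]].
  destruct (HQ y 1 Hy Rlt_0_1) as [K2 [HK2 H2]].
  apply abs_summable_le with (fun j => K1 * K2 * (/ 2) ^ j).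
  2: apply ex_series_half_geom.
  intros j. rewrite !Cmod_mult, Cmod_pow_nonneg by assumption.
  apply Rle_trans with (c ^ j * ((K1 * r ^ j) * (K2 * 1 ^ j))).
  - apply Rmult_le_compat_l; [now apply pow_le|].
    apply Rmult_le_compat; auto using Cmod_ge_0; [apply H1|apply H2]; lra.
  - replace (c ^ j * (K1 * r ^ j * (K2 * 1 ^ j)))
      with (K1 * K2 * (c ^ j * (r ^ j * 1 ^ j))) by ring.
    apply Rmult_le_compat_l; auto. now apply Rmult_le_pos.
Qed.

Lemma tensor_series_sym (c : R) (P Q : nat -> R -> C) (x y : R) :
  tensor_series c P Q x y = tensor_series c Q P y x.
Proof.
  apply Csum_ext. intros; ring.
Qed.

Lemma tensor_series_lin_r (c : R) (a : C) (P Q Q' : nat -> R -> C) (x y : R) :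
  0 <= c -> rapid P -> rapid Q -> rapid Q' -> 0 <= x -> 0 <= y ->
  tensor_series c P (lin a Q Q') x y = (a * tensor_series c P Q x y + tensor_series c P Q' x y)%C.
Proof.
  intros. unfold tensor_series. rewrite <- Csum_lin by now apply abs_summable_tensor_series.
  apply Csum_ext. intros j. unfold lin. ring.
Qed.

Lemma tensor_series_lin_l (c : R) (a : C) (P P' Q : nat -> R -> C) (x y : R) :
  0 <= c -> rapid P -> rapid P' -> rapid Q -> 0 <= x -> 0 <= y ->
  tensor_series c (lin a P P') Q x y = (a * tensor_series c P Q x y + tensor_series c P' Q x y)%C.
Proof.
  intros. rewrite !(tensor_series_sym c _ Q). now apply tensor_series_lin_r.
Qed.

(** Moving the shift from one factor to the other is what couples the two
    oscillators: forcing [Q] by its predecessor amounts to advancing [P]. *)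
Lemma tensor_series_shift (c : R) (P Q : nat -> R -> C) (x y : R) :
  0 <= c -> rapid P -> rapid Q -> 0 <= x -> 0 <= y ->
  tensor_series c P (shift Q) x y = (RtoC c * tensor_series c (fun j => P (S j)) Q x y)%C.
Proof.
  intros Hc HP HQ Hx Hy. unfold tensor_series.
  rewrite Csum_incr_1 by (apply abs_summable_tensor_series; auto using rapid_shift).
  simpl shift. rewrite <- Csum_scal
    by (apply (abs_summable_tensor_series c (fun j => P (S j))); auto using rapid_succ).
  rewrite Cmult_0_r, Cmult_0_r, Cplus_0_l. apply Csum_ext.
  intros j. simpl pow. rewrite RtoC_mult. ring.
Qed.

(** The quadratic remainders of the terms sum to [O((z - y)^2)]. *)
Lemma is_derive_half_tensor_series_r (c w : R) (P Q Q' : nat -> R -> C) (x y : R) :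
  0 <= c -> 0 <= w -> rapid P -> rapid Q -> rapid Q' -> rapid_derive Q Q' ->
  0 <= x -> 0 <= y ->
  is_derive_half (fun y => tensor_series c P Q x (w * y)%R) y
    (RtoC w * tensor_series c P Q' x (w * y)%R).
Proof.
  intros Hc Hw HP HQ HQ' HD Hx Hy.
  destruct (ratio_spec c Hc) as [r [Hr Hrj]].
  assert (HB : 0 <= w * (y + 1)) by nra.
  destruct (HP x r Hx Hr) as [K1 [HK1 H1]].
  destruct (HD (w * (y + 1)) 1 HB Rlt_0_1) as [K2 [HK2 H2]].
  rewrite is_derive_half_eps by assumption. intros eps Heps.
  set (L := 2 * (K1 * K2) * w ^ 2 + 1).
  assert (HL : 0 < L) by (unfold L; assert (0 <= K1 * K2 * w ^ 2)
    by (apply Rmult_le_pos; [nra|apply pow2_ge_0]); nra).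
  exists (Rmin 1 (eps / L)). split.
  { apply Rmin_pos; [lra|]. now apply Rdiv_lt_0_compat. }
  intros z Hz Hzy.
  assert (Hz1 : Rabs (z - y) < 1) by (eapply Rlt_le_trans; [exact Hzy|apply Rmin_l]).
  assert (Hz2 : Rabs (z - y) < eps / L)
    by (eapply Rlt_le_trans; [exact Hzy|apply Rmin_r]).
  assert (Hzb : z <= y + 1) by (split_Rabs; lra).
  assert (Hwy : 0 <= w * y) by nra. assert (Hwz : 0 <= w * z) by nra.
  unfold tensor_series.
  replace (Csum (fun j => RtoC (c ^ j) * (P j x * Q j (w * z)%R))
    - Csum (fun j => RtoC (c ^ j) * (P j x * Q j (w * y)%R))
    - RtoC (z - y) * (RtoC w * Csum (fun j => RtoC (c ^ j) * (P j x * Q' j (w * y)%R))))%C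
  with (Csum (fun j => (- RtoC (w * z - w * y)) * (RtoC (c ^ j) * (P j x * Q' j (w * y)%R))
     + (RtoC (c ^ j) * (P j x * Q j (w * z)%R) - RtoC (c ^ j) * (P j x * Q j (w * y)%R)))%C).
  2: { rewrite Csum_lin.
    - rewrite Csum_minus by now apply abs_summable_tensor_series.
      rewrite RtoC_minus, !RtoC_mult, RtoC_minus. ring.
    - now apply abs_summable_tensor_series.
    - apply abs_summable_le with (fun j => Cmod (RtoC (c ^ j) * (P j x * Q j (w * z)%R))%C
        + Cmod (RtoC (c ^ j) * (P j x * Q j (w * y)%R))%C).
      + intros j. eapply Rle_trans; [apply Cmod_triangle|]. rewrite Cmod_opp. lra.
      + apply (ex_series_plus (V:=R_NormedModule)); now apply abs_summable_tensor_series. }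
  apply Rle_trans with (Series (fun j => K1 * K2 * (w * z - w * y) ^ 2 * (/ 2) ^ j)).
  - apply Cmod_Csum_le; [|apply ex_series_half_geom]. intros j.
    replace (- RtoC (w * z - w * y) * (RtoC (c ^ j) * (P j x * Q' j (w * y)%R))
      + (RtoC (c ^ j) * (P j x * Q j (w * z)%R) - RtoC (c ^ j) * (P j x * Q j (w * y)%R)))%C
      with (RtoC (c ^ j) * (P j x * (Q j (w * z)%R - Q j (w * y)%R
               - RtoC (w * z - w * y) * Q' j (w * y)%R)))%C by ring.
    rewrite !Cmod_mult, Cmod_pow_nonneg by assumption.
    apply Rle_trans with (c ^ j * ((K1 * r ^ j) * (K2 * 1 ^ j * (w * z - w * y) ^ 2))).
    + apply Rmult_le_compat_l; [now apply pow_le|].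
      apply Rmult_le_compat; auto using Cmod_ge_0; [apply H1; lra|].
      apply H2; split; nra.
    + replace (c ^ j * (K1 * r ^ j * (K2 * 1 ^ j * (w * z - w * y) ^ 2)))
        with (K1 * K2 * (w * z - w * y) ^ 2 * (c ^ j * (r ^ j * 1 ^ j))) by ring.
      apply Rmult_le_compat_l; auto.
      apply Rmult_le_pos; [now apply Rmult_le_pos|apply pow2_ge_0].
  - rewrite Series_half_geom.
    replace (2 * (K1 * K2 * (w * z - w * y) ^ 2))
      with (2 * (K1 * K2) * w ^ 2 * (z - y) ^ 2) by ring.
    rewrite <- (pow2_abs (z - y)).
    apply Rle_trans with (L * Rabs (z - y) ^ 2).
    + apply Rmult_le_compat_r; [apply pow2_ge_0|]. unfold L; lra.
    + simpl. rewrite Rmult_1_r, <- Rmult_assoc.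
      apply Rmult_le_compat_r; [apply Rabs_pos|].
      apply Rmult_lt_compat_l with (r := L) in Hz2; auto.
      replace (L * (eps / L)) with eps in Hz2 by (field; lra). lra.
Qed.

Lemma is_derive_half_tensor_series_l (c w : R) (P P' Q : nat -> R -> C) (x y : R) :
  0 <= c -> 0 <= w -> rapid P -> rapid P' -> rapid Q -> rapid_derive P P' ->
  0 <= x -> 0 <= y ->
  is_derive_half (fun x => tensor_series c P Q (w * x)%R y) x
    (RtoC w * tensor_series c P' Q (w * x)%R y).
Proof.
  intros. rewrite tensor_series_sym.
  assert (Hd : is_derive_half (fun x => tensor_series c Q P y (w * x)%R) x
    (RtoC w * tensor_series c Q P' y (w * x)%R)) by now apply is_derive_half_tensor_series_r.
  rewrite is_derive_half_eps in * by assumption.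
  intros eps Heps. destruct (Hd eps Heps) as [d [Hd0 Hd1]].
  exists d. split; auto. intros z Hz Hzx. specialize (Hd1 z Hz Hzx).
  rewrite (tensor_series_sym c P Q (w * z)%R y), (tensor_series_sym c P Q (w * x)%R y). exact Hd1.
Qed.

Lemma rapid_lipschitz (P P' : nat -> R -> C) : rapid P' -> rapid_derive P P' ->
  forall B r, 0 <= B -> 0 < r -> exists K, 0 <= K /\
    forall j x y, 0 <= x <= B -> 0 <= y <= B ->
      Cmod (P j y - P j x)%C <= K * r ^ j * Rabs (y - x).
Proof.
  intros HP' HD B r HB Hr.
  destruct (HP' B r HB Hr) as [K1 [HK1 H1]].
  destruct (HD B r HB Hr) as [K2 [HK2 H2]].
  exists (K1 + K2 * B). split; [nra|]. intros j x y Hx Hy.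
  replace (P j y - P j x)%C with ((P j y - P j x - RtoC (y - x) * P' j x)
    + RtoC (y - x) * P' j x)%C by ring.
  eapply Rle_trans; [apply Cmod_triangle|]. rewrite Cmod_mult, Cmod_R.
  specialize (H1 j x Hx). specialize (H2 j x y Hx Hy).
  assert (Hb : Rabs (y - x) <= B) by (split_Rabs; lra).
  rewrite <- (pow2_abs (y - x)) in H2. pose proof (Rabs_pos (y - x)) as Hp.
  set (a := Rabs (y - x)) in *. pose proof (pow_lt r j Hr).
  assert (K2 * r ^ j * a ^ 2 <= K2 * r ^ j * (B * a)).
  { apply Rmult_le_compat_l; [nra|]. nra. }
  assert (a * Cmod (P' j x) <= a * (K1 * r ^ j)) by (apply Rmult_le_compat_l; auto).
  nra.
Qed.

Lemma continuous_tensor_series (c w w' : R) (P P' Q Q' : nat -> R -> C) :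
  0 <= c -> 0 <= w -> 0 <= w' -> rapid P -> rapid P' -> rapid_derive P P' ->
  rapid Q -> rapid Q' -> rapid_derive Q Q' ->
  continuous_on_quadrant (fun t z => tensor_series c P Q (w * t)%R (w' * z)%R).
Proof.
  intros Hc Hw Hw' HP HP' HPD HQ HQ' HQD [t z] [Ht Hz]. cbn [fst snd] in *.
  apply (filterlim_locally (F:=within quadrant (locally (t, z)))
    (U:=C_UniformSpace) (fun q : R * R => tensor_series c P Q (w * fst q) (w' * snd q))).
  intros eps. destruct (ratio_spec c Hc) as [r [Hr Hrj]].
  assert (HB : 0 <= w * (t + 1)) by nra.
  assert (HB' : 0 <= w' * (z + 1)) by nra.
  destruct (HP _ r HB Hr) as [K1 [HK1 H1]].
  destruct (HQ _ 1 HB' Rlt_0_1) as [K2 [HK2 H2]].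
  destruct (rapid_lipschitz P P' HP' HPD _ r HB Hr) as [L1 [HL1 M1]].
  destruct (rapid_lipschitz Q Q' HQ' HQD _ 1 HB' Rlt_0_1) as [L2 [HL2 M2]].
  set (L := 2 * (L1 * K2 * w + K1 * L2 * w') + 1).
  assert (HLp : 0 < L).
  { unfold L. assert (0 <= L1 * K2 * w) by (repeat apply Rmult_le_pos; auto).
    assert (0 <= K1 * L2 * w') by (repeat apply Rmult_le_pos; auto). lra. }
  assert (Hd : 0 < Rmin 1 (eps / L)).
  { apply Rmin_pos; [lra|]. apply Rdiv_lt_0_compat; [apply cond_pos|auto]. }
  exists (mkposreal _ Hd). intros [t' z'] [Hbt Hbz] [Ht' Hz']. cbn [fst snd] in *.
  change (Rabs (t' - t) < Rmin 1 (eps / L)) in Hbt.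
  change (Rabs (z' - z) < Rmin 1 (eps / L)) in Hbz.
  set (d := Rmin 1 (eps / L)) in *.
  assert (Hd1 : d <= 1) by apply Rmin_l.
  assert (Hd2 : d <= eps / L) by apply Rmin_r.
  assert (Htb : t' <= t + 1) by (split_Rabs; lra).
  assert (Hzb : z' <= z + 1) by (split_Rabs; lra).
  assert (Hwt : 0 <= w * t <= w * (t + 1)) by nra.
  assert (Hwt' : 0 <= w * t' <= w * (t + 1)) by nra.
  assert (Hwz : 0 <= w' * z <= w' * (z + 1)) by nra.
  assert (Hwz' : 0 <= w' * z' <= w' * (z + 1)) by nra.
  assert (Hlt : Cmod (tensor_series c P Q (w * t')%R (w' * z')%R
      - tensor_series c P Q (w * t)%R (w' * z)%R)%C < eps).
  { unfold tensor_series. rewrite <- Csum_minus by (apply abs_summable_tensor_series; auto; lra).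
    apply Rle_lt_trans with
      (Series (fun j => (L1 * K2 * w + K1 * L2 * w') * d * (/ 2) ^ j)).
    - apply Cmod_Csum_le; [|apply ex_series_half_geom]. intros j.
      replace (RtoC (c ^ j) * (P j (w * t')%R * Q j (w' * z')%R)
         - RtoC (c ^ j) * (P j (w * t)%R * Q j (w' * z)%R))%C
      with (RtoC (c ^ j) * ((P j (w * t')%R - P j (w * t)%R) * Q j (w' * z')%R
         + P j (w * t)%R * (Q j (w' * z')%R - Q j (w' * z)%R)))%C by ring.
      rewrite Cmod_mult, Cmod_pow_nonneg by assumption.
      apply Rle_trans with (c ^ j * ((L1 * r ^ j * (w * d)) * (K2 * 1 ^ j)
         + (K1 * r ^ j) * (L2 * 1 ^ j * (w' * d)))).
      + apply Rmult_le_compat_l; [now apply pow_le|].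
        eapply Rle_trans; [apply Cmod_triangle|]. rewrite !Cmod_mult.
        apply Rplus_le_compat; apply Rmult_le_compat; auto using Cmod_ge_0.
        * eapply Rle_trans; [apply M1; lra|].
          apply Rmult_le_compat_l; [apply Rmult_le_pos; auto; left; now apply pow_lt|].
          rewrite <- Rmult_minus_distr_l, Rabs_mult, (Rabs_pos_eq w) by auto.
          apply Rmult_le_compat_l; auto. lra.
        * eapply Rle_trans; [apply M2; lra|].
          apply Rmult_le_compat_l; [apply Rmult_le_pos; auto; left; apply pow_lt; lra|].
          rewrite <- Rmult_minus_distr_l, Rabs_mult, (Rabs_pos_eq w') by auto.
          apply Rmult_le_compat_l; auto. lra.
      + replace (c ^ j * (L1 * r ^ j * (w * d) * (K2 * 1 ^ j)
          + K1 * r ^ j * (L2 * 1 ^ j * (w' * d))))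
          with ((L1 * K2 * w + K1 * L2 * w') * d * (c ^ j * (r ^ j * 1 ^ j))) by ring.
        apply Rmult_le_compat_l; auto. apply Rmult_le_pos; [|lra].
        unfold L in HLp. assert (0 <= L1 * K2 * w) by (repeat apply Rmult_le_pos; auto).
        assert (0 <= K1 * L2 * w') by (repeat apply Rmult_le_pos; auto). lra.
    - rewrite Series_half_geom.
      assert (L * d <= eps).
      { apply Rmult_le_compat_l with (r := L) in Hd2; [|lra].
        replace (L * (eps / L)) with (pos eps) in Hd2 by (field; lra). lra. }
      unfold L in *. lra. }
  split.
  - eapply Rle_lt_trans; [|exact Hlt]. eapply Rle_trans; [|apply Rmax_Cmod]. apply Rmax_l.
  - eapply Rle_lt_trans; [|exact Hlt]. eapply Rle_trans; [|apply Rmax_Cmod]. apply Rmax_r.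
Qed.

(** * An explicit solution *)

Definition prev' : nat -> R -> C := im_seq (shift osc').
Definition osc'' : nat -> R -> C := lin Ci osc' prev'.

Lemma rapid_prev : rapid prev.
Proof. apply rapid_im, rapid_shift, rapid_osc. Qed.

Lemma rapid_osc' : rapid osc'.
Proof. apply rapid_lin; [apply rapid_osc | apply rapid_prev]. Qed.

Lemma rapid_prev' : rapid prev'.
Proof. apply rapid_im, rapid_shift, rapid_osc'. Qed.

Lemma rapid_osc'' : rapid osc''.
Proof. apply rapid_lin; [apply rapid_osc' | apply rapid_prev']. Qed.

Lemma rapid_derive_prev : rapid_derive prev prev'.
Proof. apply rapid_derive_im, rapid_derive_shift, rapid_derive_osc. Qed.

Lemma rapid_derive_osc' : rapid_derive osc' osc''.
Proof. apply rapid_derive_lin; [apply rapid_derive_osc | apply rapid_derive_prev]. Qed.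

Lemma osc'_conj (j : nat) (x : R) :
  Cconj (osc' j x) = (- Ci * Cconj (osc j x) + prev j x)%C.
Proof.
  unfold osc', lin, prev, im_seq.
  apply injective_projections; simpl; ring.
Qed.

(** The part of the equations of [u] and [v] that the free propagation
    [exp (- i k^2 z)] does not cancel; it reproduces [n] through
    [tensor_series_shift]. *)
Lemma prev_prev' (j : nat) (x : R) :
  (prev' j x - Ci * prev j x)%C = shift (conj_seq osc) j x.
Proof.
  destruct j as [|i]; unfold prev', prev, im_seq, shift;
    [apply injective_projections; simpl; ring|].
  unfold osc', conj_seq, lin, prev, im_seq. apply injective_projections; simpl; ring.
Qed.

Lemma osc''_eq (j : nat) (x : R) : osc'' (S j) x = (osc j x - osc (S j) x)%C.
Proof.
  unfold osc'', lin, prev', im_seq, shift, osc', lin, prev, im_seq, shift.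
  apply injective_projections; cbn -[osc]; ring.
Qed.

Create HintDb rapid discriminated.
#[local] Hint Constants Opaque : rapid.
#[local] Hint Resolve rapid_prev rapid_osc rapid_osc' rapid_prev' rapid_osc''
  rapid_derive_prev rapid_derive_osc' rapid_derive_osc rapid_zero rapid_derive_zero
  rapid_lin rapid_conj rapid_derive_lin rapid_derive_conj : rapid.

Lemma rapid_osc_succ : rapid (fun j => osc (S j)).
Proof. apply rapid_succ, rapid_osc. Qed.
Lemma rapid_osc'_succ : rapid (fun j => osc' (S j)).
Proof. apply (rapid_succ osc'), rapid_osc'. Qed.
Lemma rapid_osc''_succ : rapid (fun j => osc'' (S j)).
Proof. apply (rapid_succ osc''), rapid_osc''. Qed.
Lemma rapid_derive_osc_succ :
  rapid_derive (fun j => osc (S j)) (fun j => osc' (S j)).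
Proof. apply (rapid_derive_succ osc osc'), rapid_derive_osc. Qed.
Lemma rapid_derive_osc'_succ :
  rapid_derive (fun j => osc' (S j)) (fun j => osc'' (S j)).
Proof. apply (rapid_derive_succ osc' osc''), rapid_derive_osc'. Qed.

#[local] Hint Resolve rapid_osc_succ rapid_osc'_succ rapid_osc''_succ
  rapid_derive_osc_succ rapid_derive_osc'_succ : rapid.

Lemma tensor_series_ext (c : R) (P Q P' Q' : nat -> R -> C) (x y : R) :
  (forall j, P j x = P' j x) -> (forall j, Q j y = Q' j y) ->
  tensor_series c P Q x y = tensor_series c P' Q' x y.
Proof.
  intros HP HQ. apply Csum_ext. intros j. now rewrite HP, HQ.
Qed.

Lemma tensor_series_0_r (c : R) (P Q : nat -> R -> C) (x y : R) :
  (forall j, Q j y = 0) -> tensor_series c P Q x y = 0.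
Proof.
  intros H. unfold tensor_series. rewrite <- Csum_0. apply Csum_ext. intros j.
  rewrite H. ring.
Qed.

Lemma tensor_series_0_l (c : R) (P Q : nat -> R -> C) (x y : R) :
  (forall j, P j x = 0) -> tensor_series c P Q x y = 0.
Proof.
  intros H. rewrite tensor_series_sym. now apply tensor_series_0_r.
Qed.

Lemma tensor_series_zero (c : R) (P : nat -> R -> C) (x y : R) :
  tensor_series c P zero_seq x y = 0.
Proof. now apply tensor_series_0_r. Qed.

Lemma osc_eq_0 (j : nat) : osc (S j) 0 = 0.
Proof.
  destruct (osc_0 (S j)) as [H1 H2]. apply injective_projections; [|exact H1].
  now apply H2.
Qed.

Lemma osc'_eq_0 (j : nat) : osc' (S j) 0 = 0.
Proof.
  unfold osc', lin. rewrite osc_eq_0. unfold prev, im_seq, shift.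
  destruct (osc_0 j) as [H1 _]. rewrite H1. ring.
Qed.

Lemma prev_0 (j : nat) : prev j 0 = 0.
Proof.
  unfold prev, im_seq, shift. destruct j as [|i]; [reflexivity|].
  destruct (osc_0 i) as [H1 _]. now rewrite H1.
Qed.

Section Construction.

Context (E : C) (k : R) (hE : E <> 0) (hk : 0 < k).

(** In the variable [y = k^2 z] the operator [d_z^2 + k^4] is [k^4 (d_y^2 + 1)], so
    this is the ratio for which advancing [n] by one term in [z] produces the
    right-hand side [- 2 A k^2 n]. *)
Definition coupling : R := 2 * Cmod E ^ 2 / k ^ 2.

(** [u] and [v] are recovered from [w] and [w_z]: [conj(E) u] and [E v] are the
    half sum and half difference of [w] and [i w_z / k^2], and
    [(conj (osc j))' = - i conj (osc j) + prev j]. *)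
Definition u_factor : nat -> R -> C := lin (Ci / 2) prev (conj_seq osc).
Definition v_factor : nat -> R -> C :=
  lin (- (Ci / 2) * (Cconj E / E)) prev zero_seq.
Definition n_factor : nat -> R -> C := lin (- Cconj E) (conj_seq osc) zero_seq.

Definition sol_u (t z : R) : C := tensor_series coupling osc u_factor (k * t) (k ^ 2 * z).
Definition sol_v (t z : R) : C := tensor_series coupling osc v_factor (k * t) (k ^ 2 * z).
Definition sol_n (t z : R) : C :=
  tensor_series coupling (fun j => osc (S j)) n_factor (k * t) (k ^ 2 * z).

Lemma coupling_nonneg : 0 <= coupling.
Proof.
  unfold coupling. apply Rdiv_le_0_compat.
  - pose proof (pow2_ge_0 (Cmod E)). lra.
  - now apply pow_lt.
Qed.

Lemma coupling_spec : (RtoC (k ^ 2) * RtoC coupling = 2 * (E * Cconj E))%C.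
Proof.
  rewrite <- Cmod2_conj. rewrite <- RtoC_mult.
  replace (k ^ 2 * coupling) with (2 * Cmod E ^ 2)
    by (unfold coupling; field; lra).
  rewrite RtoC_mult, RtoC_pow. reflexivity.
Qed.

Lemma rapid_u_factor : rapid u_factor. Proof. unfold u_factor. auto with rapid. Qed.
Lemma rapid_v_factor : rapid v_factor. Proof. unfold v_factor. auto with rapid. Qed.
Lemma rapid_n_factor : rapid n_factor. Proof. unfold n_factor. auto with rapid. Qed.

Definition u_factor' : nat -> R -> C := lin (Ci / 2) prev' (conj_seq osc').
Definition v_factor' : nat -> R -> C :=
  lin (- (Ci / 2) * (Cconj E / E)) prev' zero_seq.

Lemma rapid_u_factor' : rapid u_factor'. Proof. unfold u_factor'. auto with rapid. Qed.
Lemma rapid_v_factor' : rapid v_factor'. Proof. unfold v_factor'. auto with rapid. Qed.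
Lemma rapid_derive_u_factor : rapid_derive u_factor u_factor'.
Proof. unfold u_factor, u_factor'. auto with rapid. Qed.
Lemma rapid_derive_v_factor : rapid_derive v_factor v_factor'.
Proof. unfold v_factor, v_factor'. auto with rapid. Qed.

Hint Resolve coupling_nonneg rapid_u_factor rapid_v_factor rapid_n_factor
  rapid_u_factor' rapid_v_factor'
  rapid_derive_u_factor rapid_derive_v_factor : rapid.

Lemma sol_n_eq (t z : R) : 0 <= t -> 0 <= z ->
  sol_n t z = (- Cconj E * tensor_series coupling (fun j => osc (S j)) (conj_seq osc)
                 (k * t) (k ^ 2 * z))%C.
Proof.
  intros Ht Hz. assert (0 <= k * t) by nra. assert (0 <= k ^ 2 * z) by nra.
  unfold sol_n, n_factor. rewrite tensor_series_lin_r, tensor_series_zero by auto with rapid. ring.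
Qed.

Lemma zakharov_exists :
  zakharov_solution E k (fun t => cis (k * t)) (fun _ => RtoC 0) sol_u sol_v sol_n.
Proof.
  assert (hk' : 0 <= k) by lra.
  assert (hk2 : 0 <= k ^ 2) by (apply pow2_ge_0).
  split.
  - apply (continuous_tensor_series _ _ _ _ osc' _ u_factor'); auto with rapid.
  - apply (continuous_tensor_series _ _ _ _ osc' _ v_factor'); auto with rapid.
  - apply (continuous_tensor_series _ _ _ _ (fun j => osc' (S j)) _
      (lin (- Cconj E) (conj_seq osc') zero_seq)); unfold n_factor; auto with rapid.
  - intros t z Ht Hz. assert (Hkt : 0 <= k * t) by nra.
    assert (Hkz : 0 <= k ^ 2 * z) by nra.
    exists (RtoC (k ^ 2) * tensor_series coupling osc u_factor' (k * t) (k ^ 2 * z)%R)%C.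
    split; [apply is_derive_half_tensor_series_r; auto with rapid|].
    rewrite sol_n_eq by assumption. unfold sol_u.
    assert (Hb : tensor_series coupling osc (lin Ci u_factor' (lin (- (1)) u_factor zero_seq))
       (k * t) (k ^ 2 * z)
       = tensor_series coupling osc (lin (- (1 / 2)) (shift (conj_seq osc)) zero_seq)
          (k * t) (k ^ 2 * z)).
    { apply tensor_series_ext; auto. intros j.
      unfold u_factor, u_factor', lin, zero_seq.
      rewrite <- prev_prev'. unfold conj_seq. rewrite osc'_conj.
      apply injective_projections; simpl; field. }
    rewrite !tensor_series_lin_r, tensor_series_zero, tensor_series_shift in Hb
      by (auto using rapid_shift with rapid).
    pose proof coupling_spec as Hc.
    set (b := tensor_series coupling (fun j => osc (S j)) _ _ _) in *.
    set (bu := tensor_series coupling osc u_factor _ _) in *.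
    set (bu' := tensor_series coupling osc u_factor' _ _) in *.
    transitivity (RtoC (k ^ 2) * (Ci * bu' + (- (1) * bu + 0))
      + E * Cconj E * b)%C; [ring|].
    rewrite Hb.
    transitivity (- (1 / 2) * (RtoC (k ^ 2) * RtoC coupling) * b + E * Cconj E * b)%C;
      [ring|]. rewrite Hc. field.
  - intros t z Ht Hz. assert (Hkt : 0 <= k * t) by nra.
    assert (Hkz : 0 <= k ^ 2 * z) by nra.
    exists (RtoC (k ^ 2) * tensor_series coupling osc v_factor' (k * t) (k ^ 2 * z)%R)%C.
    split; [apply is_derive_half_tensor_series_r; auto with rapid|].
    rewrite sol_n_eq by assumption. unfold sol_v.
    assert (Hb : tensor_series coupling osc (lin Ci v_factor' (lin 1 v_factor zero_seq))
       (k * t) (k ^ 2 * z)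
       = tensor_series coupling osc (lin (1 / 2 * (Cconj E / E)) (shift (conj_seq osc)) zero_seq)
          (k * t) (k ^ 2 * z)).
    { apply tensor_series_ext; auto. intros j.
      unfold v_factor, v_factor', lin, zero_seq.
      rewrite <- prev_prev'. generalize (Cconj E / E)%C as a. intros a.
      apply injective_projections; simpl; field. }
    rewrite !tensor_series_lin_r, tensor_series_zero, tensor_series_shift in Hb
      by (auto using rapid_shift with rapid).
    pose proof coupling_spec as Hc.
    set (b := tensor_series coupling (fun j => osc (S j)) _ _ _) in *.
    set (bu := tensor_series coupling osc v_factor _ _) in *.
    set (bu' := tensor_series coupling osc v_factor' _ _) in *.
    transitivity (RtoC (k ^ 2) * (Ci * bu' + (1 * bu + 0))
      - Cconj E * Cconj E * b)%C; [ring|].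
    rewrite Hb.
    transitivity (1 / 2 * (Cconj E / E) * (RtoC (k ^ 2) * RtoC coupling) * b
      - Cconj E * Cconj E * b)%C;
      [ring|]. rewrite Hc. field. exact hE.
  - exists (fun t z => RtoC k * tensor_series coupling (fun j => osc' (S j)) n_factor
               (k * t)%R (k ^ 2 * z)%R)%C.
    split; [|split].
    + intros t z Ht Hz. assert (Hkz : 0 <= k ^ 2 * z) by nra.
      apply (is_derive_half_tensor_series_l coupling k (fun j => osc (S j))
        (fun j => osc' (S j)) n_factor t (k ^ 2 * z)); auto with rapid.
    + intros t z Ht Hz. assert (Hkt : 0 <= k * t) by nra.
      assert (Hkz : 0 <= k ^ 2 * z) by nra.
      exists (RtoC k * (RtoC k * tensor_series coupling (fun j => osc'' (S j)) n_factor
               (k * t)%R (k ^ 2 * z)%R))%C.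
      split.
      { assert (Hd := is_derive_half_tensor_series_l coupling k (fun j => osc' (S j))
          (fun j => osc'' (S j)) n_factor t (k ^ 2 * z)).
        specialize (Hd ltac:(auto with rapid) hk' ltac:(auto with rapid)
          ltac:(auto with rapid) ltac:(auto with rapid) ltac:(auto with rapid) Ht Hkz).
        rewrite is_derive_half_eps in * by assumption.
        intros eps Heps. destruct (Hd (eps / k)) as [d [Hd0 Hd1]].
        { now apply Rdiv_lt_0_compat. }
        exists d. split; auto. intros y Hy Hyt. specialize (Hd1 y Hy Hyt).
        match goal with |- Cmod ?a <= _ =>
          replace a with (RtoC k *
            (tensor_series coupling (fun j => osc' (S j)) n_factor (k * y)%R (k ^ 2 * z)%R
            - tensor_series coupling (fun j => osc' (S j)) n_factor (k * t)%R (k ^ 2 * z)%R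
            - RtoC (y - t) * (RtoC k * tensor_series coupling (fun j => osc'' (S j)) n_factor
               (k * t)%R (k ^ 2 * z)%R)))%C by ring end.
        rewrite Cmod_mult, Cmod_R, (Rabs_pos_eq k) by assumption.
        apply Rmult_le_compat_l with (r := k) in Hd1; auto.
        replace (k * (eps / k * Rabs (y - t))) with (eps * Rabs (y - t)) in Hd1
          by (field; lra). exact Hd1. }
      unfold sol_n, sol_u, sol_v.
      assert (Hb : tensor_series coupling (fun j => osc'' (S j)) n_factor (k * t) (k ^ 2 * z)
        = tensor_series coupling (lin (- (1)) (fun j => osc (S j)) osc) n_factor
            (k * t) (k ^ 2 * z)).
      { apply tensor_series_ext; auto. intros j. rewrite osc''_eq. unfold lin. ring. }
      rewrite tensor_series_lin_l in Hb by auto with rapid.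
      assert (Hs : tensor_series coupling osc (lin (Cconj E) u_factor (lin E v_factor n_factor))
          (k * t) (k ^ 2 * z) = 0).
      { refine (tensor_series_0_r _ _ _ _ _ _). intros j.
        unfold u_factor, v_factor, n_factor, lin, zero_seq.
        generalize (prev j (k ^ 2 * z)) as p. generalize (conj_seq osc j (k ^ 2 * z)) as q.
        intros q p. field. exact hE. }
      rewrite !tensor_series_lin_r in Hs by auto with rapid.
      rewrite Hb.
      set (bn := tensor_series coupling (fun j => osc (S j)) n_factor _ _) in *.
      set (b0 := tensor_series coupling osc n_factor _ _) in *.
      set (bu := tensor_series coupling osc u_factor _ _) in *.
      set (bv := tensor_series coupling osc v_factor _ _) in *.
      replace (RtoC (k ^ 2)) with (RtoC k * RtoC k)%C
        by (rewrite <- RtoC_mult; f_equal; ring).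
      transitivity (RtoC k * RtoC k * (Cconj E * bu + (E * bv + b0)))%C; [ring|].
      rewrite Hs. ring.
    + intros z Hz. rewrite Rmult_0_r, tensor_series_0_l; [ring|]. apply osc'_eq_0.
  - intros z Hz. unfold sol_n. rewrite Rmult_0_r. apply tensor_series_0_l. apply osc_eq_0.
  - intros t Ht. assert (Hkt : 0 <= k * t) by nra.
    unfold sol_u, tensor_series. rewrite Rmult_0_r.
    rewrite Csum_incr_1 by (apply abs_summable_tensor_series; auto with rapid; lra).
    rewrite (Csum_ext (fun j => _ * (osc (S j) _ * _))%C (fun _ => 0)).
    + rewrite Csum_0. unfold u_factor, lin, conj_seq. rewrite prev_0.
      simpl. rewrite cos_0, sin_0. unfold cis.
      apply injective_projections; simpl; field.
    + intros j. unfold u_factor, lin, conj_seq. rewrite prev_0, osc_eq_0.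
      apply injective_projections; simpl; ring.
  - intros t Ht. unfold sol_v. rewrite Rmult_0_r. apply tensor_series_0_r.
    intros j. unfold v_factor, lin, zero_seq. rewrite prev_0. ring.
Qed.

End Construction.

Lemma continuous_on_quadrant_const (a : C) :
  continuous_on_quadrant (fun _ _ => a).
Proof.
  intros p Hp. apply filterlim_const.
Qed.

(** At [k = 0] the coupling constant degenerates, but the system decouples. *)
Lemma zakharov_exists_0 (E : C) :
  zakharov_solution E 0 (fun t => cis (0 * t)) (fun _ => RtoC 0)
    (fun _ _ => 1) (fun _ _ => 0) (fun _ _ => 0).
Proof.
  assert (Hd : forall (a : C) (x : R), 0 <= x -> is_derive_half (fun _ => a) x 0).
  { intros a x Hx. rewrite is_derive_half_eps by assumption.
    intros eps Heps. exists 1. split; [lra|]. intros y Hy Hyx.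
    replace (a - a - RtoC (y - x) * 0)%C with (RtoC 0) by ring. rewrite Cmod_0.
    pose proof (Rabs_pos (y - x)). nra. }
  split; try apply continuous_on_quadrant_const; auto.
  - intros t z Ht Hz. exists 0. split; auto.
    apply injective_projections; simpl; ring.
  - intros t z Ht Hz. exists 0. split; auto.
    apply injective_projections; simpl; ring.
  - exists (fun _ _ => 0). split; [|split]; auto.
    intros t z Ht Hz. exists 0. split; auto.
    apply injective_projections; simpl; ring.
  - intros t Ht. rewrite Rmult_0_l. symmetry. apply cis_0.
Qed.

(** * Large-argument behaviour of the oscillators *)

Lemma cis_taylor1 (y : R) : 0 <= y -> Cmod (cis y - 1)%C <= y.
Proof.
  intros Hy.
  apply (mean_value_half (fun y => (cos y - 1, sin y)) (fun y => (- sin y, cos y))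
    (fun y => y) (fun _ => 1)) in Hy; auto.
  - replace (cis y - 1)%C with ((cos y - 1, sin y) : C); auto.
    unfold cis. apply injective_projections; simpl; ring.
  - intros z Hz. apply (is_derive_half_pair (fun y => cos y - 1) sin); [lra| |];
      auto_derive; auto; ring.
  - intros z Hz. apply (is_derive_id (K:=R_AbsRing)).
  - intros z Hz. right. rewrite <- (Cmod_cis z). unfold cis, Cmod. cbn [fst snd].
    f_equal. ring.
  - rewrite cos_0, sin_0, Rminus_diag. change (0, 0) with (RtoC 0).
    rewrite Cmod_0. lra.
Qed.

Lemma cis_taylor2 (y : R) : 0 <= y ->
  Cmod (cis y - (1 + Ci * RtoC y))%C <= y ^ 2 / 2.
Proof.
  intros Hy.
  apply (mean_value_half (fun y => (cos y - 1, sin y - y))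
    (fun y => (- sin y, cos y - 1)) (fun y => y ^ 2 / 2) (fun y => y)) in Hy.
  - replace (cis y - (1 + Ci * RtoC y))%C with ((cos y - 1, sin y - y) : C); auto.
    unfold cis. apply injective_projections; simpl; ring.
  - intros z Hz. apply (is_derive_half_pair (fun y => cos y - 1) (fun y => sin y - y));
      [lra| |]; auto_derive; auto; ring.
  - intros z Hz. auto_derive; auto. field.
  - intros z Hz. eapply Rle_trans; [|apply cis_taylor1; lra]. right.
    unfold cis, Cmod. cbn -[pow]. f_equal. ring.
  - rewrite cos_0, sin_0, !Rminus_diag. change (0, 0) with (RtoC 0).
    rewrite Cmod_0. lra.
Qed.

Lemma cis_lipschitz (a b : R) : Cmod (cis a - cis b)%C <= Rabs (a - b).
Proof.
  assert (H : forall a b, b <= a -> Cmod (cis a - cis b)%C <= a - b).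
  { intros a' b' Hab. replace (cis a' - cis b')%C with (cis b' * (cis (a' - b') - 1))%C.
    - rewrite Cmod_mult, Cmod_cis, Rmult_1_l. apply cis_taylor1. lra.
    - replace a' with (b' + (a' - b')) at 2 by ring. rewrite cis_plus. ring. }
  destruct (Rle_dec b a).
  - rewrite Rabs_pos_eq by lra. now apply H.
  - rewrite <- Cmod_opp. replace (- (cis a - cis b))%C with (cis b - cis a)%C by ring.
    rewrite Rabs_minus_sym, Rabs_pos_eq by lra. apply H. lra.
Qed.

(** The increments of the phase [j^2 / (2 x)]. *)
Definition phase_incr (j : nat) (x : R) : R := (2 * INR j + 1) / (2 * x).

(** [osc j x] with its leading behaviour [(x / (2 i))^j / j!] divided out, see
    [osc_profile].  The first correction rotates the phase by [phase_incr]; the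
    second alternates in sign and averages out. *)
Fixpoint profile (j : nat) (x : R) : C :=
  match j with
  | O => cis x
  | S i => (profile i x + Ci * RtoC (phase_incr i x)
              * (profile i x - (- (1)) ^ i * Cconj (profile i x)))%C
  end.

Lemma conj_minus_Ci_pow (j : nat) :
  (Cconj ((- Ci) ^ j) = (- (1)) ^ j * (- Ci) ^ j)%C.
Proof.
  rewrite Cpow_conj, <- Cpow_mult_l. f_equal.
  apply injective_projections; simpl; ring.
Qed.

Lemma osc_profile (j : nat) (x : R) : 0 < x ->
  osc j x = (RtoC ((x / 2) ^ j / INR (fact j)) * ((- Ci) ^ j * profile j x))%C.
Proof.
  intros Hx. induction j as [|i IH].
  - simpl. apply injective_projections; simpl; field.
  - set (F := osc i x) in *.
    pose proof (pos_INR i) as Hi. pose proof (INR_fact_lt_0 i) as Hf.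
    assert (Hrec : osc (S i) x = (RtoC (/ (4 * (INR i + 1))) *
       (RtoC (2 * INR i + 1) * (F - Cconj F) - 2 * Ci * RtoC x * F))%C).
    { simpl osc. fold F. apply injective_projections; simpl; field; lra. }
    rewrite Hrec. rewrite IH.
    rewrite !Cmult_conj, conj_minus_Ci_pow.
    replace (Cconj (RtoC ((x / 2) ^ i / INR (fact i))))
      with (RtoC ((x / 2) ^ i / INR (fact i)))
      by (apply injective_projections; simpl; ring).
    replace (RtoC ((x / 2) ^ S i / INR (fact (S i))))
      with (RtoC (x / (2 * (INR i + 1))) * RtoC ((x / 2) ^ i / INR (fact i)))%C.
    2: { rewrite <- RtoC_mult. f_equal. rewrite fact_simpl, mult_INR, S_INR.
         simpl pow. field. lra. }
    set (r := RtoC (_ / INR (fact i))). simpl profile. rewrite Cpow_S.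
    set (p := ((- Ci) ^ i)%C). set (s := ((- (1)) ^ i)%C). set (ph := profile i x).
    set (phc := Cconj ph).
    transitivity (r * p * (RtoC (/ (4 * (INR i + 1))) *
       (RtoC (2 * INR i + 1) * (ph - s * phc) - 2 * Ci * RtoC x * ph)))%C; [ring|].
    transitivity (r * p * (RtoC (x / (2 * (INR i + 1))) * (- Ci) * (ph + Ci * RtoC (phase_incr i x)
      * (ph - s * phc))))%C; [|ring].
    f_equal. generalize (ph - s * phc)%C as d. intros d. unfold phase_incr.
    apply injective_projections; simpl; field; lra.
Qed.

Lemma Cmod_minus_Ci_pow (j : nat) : Cmod ((- Ci) ^ j)%C = 1.
Proof. rewrite Cmod_pow, Cmod_opp, Cmod_Ci. apply pow1. Qed.

Lemma Cmod_sign_pow (j : nat) : Cmod ((- (1)) ^ j)%C = 1.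
Proof. rewrite Cmod_pow, Cmod_opp, Cmod_1. apply pow1. Qed.

Lemma Cmod_profile_pow2 (j : nat) (x : R) : 0 < x -> Cmod (profile j x) <= 2 ^ j.
Proof.
  intros Hx. pose proof (Cmod_osc_le j x (Rlt_le _ _ Hx)) as H.
  rewrite (osc_profile j x Hx), !Cmod_mult, Cmod_minus_Ci_pow, Cmod_R in H.
  pose proof (INR_fact_lt_0 j) as Hf.
  assert (Hp : 0 < (x / 2) ^ j) by (apply pow_lt; lra).
  rewrite Rabs_pos_eq in H by (left; now apply Rdiv_lt_0_compat).
  apply Rmult_le_reg_l with ((x / 2) ^ j / INR (fact j)).
  { now apply Rdiv_lt_0_compat. }
  replace ((x / 2) ^ j / INR (fact j) * 2 ^ j) with (x ^ j / INR (fact j)).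
  - lra.
  - replace (x ^ j) with ((x / 2) ^ j * 2 ^ j)
      by (rewrite <- Rpow_mult_distr; f_equal; field).
    field. lra.
Qed.

Lemma phase_incr_nonneg (j : nat) (x : R) : 0 < x -> 0 <= phase_incr j x.
Proof.
  intros Hx. unfold phase_incr. pose proof (pos_INR j). apply Rdiv_le_0_compat; lra.
Qed.

Lemma Cmod_profile_diff (j : nat) (x : R) : 0 < x ->
  Cmod (profile (S j) x - profile j x)%C <= 2 * phase_incr j x * Cmod (profile j x).
Proof.
  intros Hx. simpl profile.
  replace (profile j x + Ci * RtoC (phase_incr j x)
              * (profile j x - (- (1)) ^ j * Cconj (profile j x)) - profile j x)%C
    with (Ci * RtoC (phase_incr j x)
              * (profile j x - (- (1)) ^ j * Cconj (profile j x)))%C by ring.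
  rewrite !Cmod_mult, Cmod_Ci, Cmod_R, Rabs_pos_eq by now apply phase_incr_nonneg.
  assert (Cmod (profile j x - (- (1)) ^ j * Cconj (profile j x))%C
           <= 2 * Cmod (profile j x)).
  { eapply Rle_trans; [apply Cmod_triangle|].
    rewrite Cmod_opp, Cmod_mult, Cmod_sign_pow, Cmod_conj. lra. }
  pose proof (phase_incr_nonneg j x Hx). nra.
Qed.

(** The increments of the profile are at most [2 * phase_incr i x] times its
    modulus, and [2 * phase_incr i x] sums to [j^2 / x]. *)
Lemma Cmod_profile_exp (j : nat) (x : R) : 0 < x ->
  Cmod (profile j x) <= exp (INR j ^ 2 / x) /\
  Cmod (profile j x - cis x)%C <= exp (INR j ^ 2 / x) - 1.
Proof.
  intros Hx. induction j as [|i [IH1 IH2]].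
  - simpl. replace (cis x - cis x)%C with (RtoC 0) by ring.
    rewrite Cmod_cis, Cmod_0. replace (0 * (0 * 1) / x) with 0 by (field; lra).
    rewrite exp_0. lra.
  - pose proof (Cmod_profile_diff i x Hx) as Hd.
    pose proof (phase_incr_nonneg i x Hx) as Hs. pose proof (Cmod_ge_0 (profile i x)).
    assert (He : exp (INR (S i) ^ 2 / x) = exp (INR i ^ 2 / x) * exp (2 * phase_incr i x)).
    { rewrite <- exp_plus. f_equal. rewrite S_INR. unfold phase_incr. field. lra. }
    pose proof (exp_ineq1_le (2 * phase_incr i x)) as He1.
    assert (H2 : 2 * phase_incr i x * Cmod (profile i x)
        <= exp (INR (S i) ^ 2 / x) - exp (INR i ^ 2 / x)).
    { rewrite He. pose proof (exp_pos (INR i ^ 2 / x)). nra. }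
    split.
    + replace (profile (S i) x) with (profile i x + (profile (S i) x - profile i x))%C
        by ring.
      eapply Rle_trans; [apply Cmod_triangle|]. lra.
    + replace (profile (S i) x - cis x)%C
        with ((profile i x - cis x) + (profile (S i) x - profile i x))%C by ring.
      eapply Rle_trans; [apply Cmod_triangle|]. lra.
Qed.

(** The profile corrected by a summation by parts of the alternating term of its
    recursion.  For this sequence the alternation appears at second order only. *)
Definition averaged (j : nat) (x : R) : C :=
  (profile j x - Ci / 2 * (- (1)) ^ j * RtoC (phase_incr j x) * Cconj (profile j x))%C.

Lemma Cmod_half_Ci : Cmod (Ci / 2)%C = / 2.
Proof.
  rewrite Cmod_div, Cmod_Ci, Cmod_R, Rabs_pos_eq by (try lra; intros H; apply RtoC_inj in H; lra).
  field.
Qed.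

Lemma Cmod_averaged_diff (j : nat) (x : R) : 0 < x ->
  Cmod (profile j x - averaged j x)%C <= phase_incr j x / 2 * Cmod (profile j x).
Proof.
  intros Hx. unfold averaged.
  replace (profile j x - (profile j x - Ci / 2 * (- (1)) ^ j * RtoC (phase_incr j x)
     * Cconj (profile j x)))%C
    with (Ci / 2 * (- (1)) ^ j * RtoC (phase_incr j x) * Cconj (profile j x))%C by ring.
  rewrite !Cmod_mult, Cmod_half_Ci, Cmod_sign_pow, Cmod_conj, Cmod_R, Rabs_pos_eq
    by now apply phase_incr_nonneg.
  right. field.
Qed.

(** The alternating terms of [profile] at first order in [phase_incr] cancel
    because consecutive signs are opposite; what is left involves the variation
    [1 / x] of [phase_incr] and its square. *)
Lemma averaged_step (j : nat) (x : R) : 0 < x ->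
  Cmod (averaged (S j) x - (1 + Ci * RtoC (phase_incr j x)) * averaged j x)%C
   <= / (2 * x) * Cmod (profile (S j) x) + 3 / 2 * phase_incr j x ^ 2 * Cmod (profile j x).
Proof.
  intros Hx. pose proof (phase_incr_nonneg j x Hx) as Hs.
  set (e := phase_incr j x) in *. set (p := profile j x). set (p1 := profile (S j) x).
  set (s := ((- (1)) ^ j)%C).
  assert (He : phase_incr (S j) x = e + / x).
  { unfold e, phase_incr. rewrite S_INR. field. lra. }
  assert (Hp1 : p1 = (p + Ci * RtoC e * (p - s * Cconj p))%C) by reflexivity.
  replace (averaged (S j) x - (1 + Ci * RtoC e) * averaged j x)%C
    with (Ci / 2 * s * (RtoC (/ x) * Cconj p1 + RtoC e * Cconj (p1 - p))
       + Ci * RtoC e * (p - averaged j x))%C.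
  2: { unfold averaged. fold p. fold p1. rewrite He. fold e. rewrite Cpow_S. fold s.
       rewrite RtoC_plus, Cminus_conj. rewrite Hp1 at 3.
       generalize (Cconj p1) as q1. generalize (Cconj p) as q. intros q q1.
       field. }
  eapply Rle_trans; [apply Cmod_triangle|].
  pose proof (Cmod_averaged_diff j x Hx) as Ha. fold p e in Ha.
  pose proof (Cmod_profile_diff j x Hx) as Hd. fold p p1 e in Hd.
  rewrite !Cmod_mult, Cmod_half_Ci, Cmod_Ci.
  replace (Cmod s) with 1 by (symmetry; apply Cmod_sign_pow).
  rewrite Cmod_R, (Rabs_pos_eq e) by assumption.
  assert (Hix : 0 < / x) by now apply Rinv_0_lt_compat.
  assert (Ht : Cmod (RtoC (/ x) * Cconj p1 + RtoC e * Cconj (p1 - p))%C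
    <= / x * Cmod p1 + e * (2 * e * Cmod p)).
  { eapply Rle_trans; [apply Cmod_triangle|].
    rewrite !Cmod_mult, !Cmod_R, !Cmod_conj, (Rabs_pos_eq e), (Rabs_pos_eq (/ x)) by lra.
    apply Rplus_le_compat_l. now apply Rmult_le_compat_l. }
  replace (/ (2 * x)) with (/ x / 2) by (field; lra).
  assert (e * Cmod (p - averaged j x)%C <= e * (e / 2 * Cmod p))
    by now apply Rmult_le_compat_l.
  lra.
Qed.

Lemma phase_incr_le (i j : nat) (x : R) : 0 < x -> (i <= j)%nat -> phase_incr i x <= phase_incr j x.
Proof.
  intros Hx Hij. unfold phase_incr. apply le_INR in Hij.
  apply Rmult_le_compat_r; [left; apply Rinv_0_lt_compat; lra|lra].
Qed.

(** The errors of [averaged_step] add up to [O(j / x + j^3 / x^2)] along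
    the rotation by the accumulated phase [j^2 / (2 x)], which is small for
    [j] of order [sqrt x] although that phase is not. *)
Lemma profile_asymptotics (j : nat) (x : R) : 0 < x -> phase_incr j x <= 2 ->
  Cmod (profile j x - cis (INR j ^ 2 / (2 * x)) * cis x)%C
   <= exp (INR j ^ 2 / x)
      * (INR j * (/ (2 * x) + 5 / 2 * phase_incr j x ^ 2) + phase_incr j x).
Proof.
  intros Hx Hs2. set (M := exp (INR j ^ 2 / x)). set (e := phase_incr j x) in *.
  assert (He : 0 <= e) by now apply phase_incr_nonneg.
  assert (Hix : 0 < / (2 * x)) by (apply Rinv_0_lt_compat; lra).
  assert (HM1 : 1 <= M).
  { unfold M. pose proof (exp_ineq1_le (INR j ^ 2 / x)).
    assert (0 <= INR j ^ 2 / x) by (apply Rdiv_le_0_compat; [apply pow2_ge_0|auto]).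
    lra. }
  assert (HM : forall i, (i <= j)%nat -> Cmod (profile i x) <= M).
  { intros i Hi. eapply Rle_trans; [apply Cmod_profile_exp; auto|].
    apply exp_le_exp. apply Rmult_le_compat_r; [left; now apply Rinv_0_lt_compat|].
    apply pow_incr. split; [apply pos_INR|now apply le_INR]. }
  assert (Hst : forall i, (i <= j)%nat -> 0 <= phase_incr i x <= e).
  { intros i Hi. split; [now apply phase_incr_nonneg|now apply phase_incr_le]. }
  set (eta := M * (/ (2 * x) + 5 / 2 * e ^ 2)).
  assert (Heta : 0 <= eta).
  { unfold eta. apply Rmult_le_pos; [lra|]. pose proof (pow2_ge_0 e). lra. }
  assert (Hit : forall i, (i <= j)%nat ->
    Cmod (averaged i x - cis (INR i ^ 2 / (2 * x)) * averaged 0 x)%C <= INR i * eta).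
  { induction i as [|i IH]; intros Hi.
    - replace (INR 0 ^ 2 / (2 * x)) with 0 by (simpl; field; lra).
      rewrite cis_0. replace (averaged 0 x - 1 * averaged 0 x)%C with (RtoC 0) by ring.
      rewrite Cmod_0. simpl; lra.
    - specialize (IH ltac:(lia)).
      pose proof (averaged_step i x Hx) as Ha.
      pose proof (Cmod_averaged_diff i x Hx) as Hb.
      pose proof (HM i ltac:(lia)) as M1. pose proof (HM (S i) Hi) as M2.
      pose proof (Hst i ltac:(lia)) as Hsi.
      assert (Hav : Cmod (averaged i x) <= 2 * M).
      { replace (averaged i x) with (profile i x + - (profile i x - averaged i x))%C by ring.
        eapply Rle_trans; [apply Cmod_triangle|]. rewrite Cmod_opp.
        pose proof (Cmod_ge_0 (profile i x)).
        assert (phase_incr i x / 2 * Cmod (profile i x) <= 1 * M)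
          by (apply Rmult_le_compat; lra). lra. }
      pose proof (cis_taylor2 (phase_incr i x) (proj1 Hsi)) as Hc.
      replace (INR (S i) ^ 2 / (2 * x)) with (phase_incr i x + INR i ^ 2 / (2 * x))
        by (rewrite S_INR; unfold phase_incr; field; lra).
      rewrite cis_plus.
      replace (averaged (S i) x - cis (phase_incr i x) * cis (INR i ^ 2 / (2 * x)) * averaged 0 x)%C
        with ((averaged (S i) x - (1 + Ci * RtoC (phase_incr i x)) * averaged i x)
          + (- ((cis (phase_incr i x) - (1 + Ci * RtoC (phase_incr i x))) * averaged i x)
          + cis (phase_incr i x) * (averaged i x - cis (INR i ^ 2 / (2 * x)) * averaged 0 x)))%C
        by ring.
      eapply Rle_trans; [apply Cmod_triangle|].
      eapply Rle_trans; [apply Rplus_le_compat_l, Cmod_triangle|].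
      rewrite Cmod_opp, !Cmod_mult, Cmod_cis, Rmult_1_l, S_INR.
      assert (Hs3 : phase_incr i x ^ 2 <= e ^ 2) by (apply pow_incr; lra).
      pose proof (pow2_ge_0 (phase_incr i x)) as Hs4.
      assert (T1 : / (2 * x) * Cmod (profile (S i) x) <= / (2 * x) * M)
        by (apply Rmult_le_compat_l; lra).
      assert (T2 : 3 / 2 * phase_incr i x ^ 2 * Cmod (profile i x) <= 3 / 2 * e ^ 2 * M).
      { apply Rmult_le_compat; try lra. apply Cmod_ge_0. }
      assert (T3 : Cmod (cis (phase_incr i x) - (1 + Ci * RtoC (phase_incr i x)))%C
          * Cmod (averaged i x)
        <= e ^ 2 / 2 * (2 * M)).
      { apply Rmult_le_compat; auto using Cmod_ge_0. lra. }
      unfold eta in *. nra. }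
  pose proof (Hit j (Nat.le_refl _)) as H1.
  pose proof (Cmod_averaged_diff j x Hx) as H2. fold e in H2.
  pose proof (Cmod_averaged_diff 0 x Hx) as H3.
  simpl profile in H3. rewrite Cmod_cis in H3.
  pose proof (Hst 0%nat ltac:(lia)) as H4.
  replace (profile j x - cis (INR j ^ 2 / (2 * x)) * cis x)%C
    with ((profile j x - averaged j x)
      + ((averaged j x - cis (INR j ^ 2 / (2 * x)) * averaged 0 x)
      + - (cis (INR j ^ 2 / (2 * x)) * (cis x - averaged 0 x))))%C by ring.
  eapply Rle_trans; [apply Cmod_triangle|].
  eapply Rle_trans; [apply Rplus_le_compat_l, Cmod_triangle|].
  rewrite Cmod_opp, Cmod_mult, Cmod_cis, Rmult_1_l.
  assert (e / 2 * Cmod (profile j x) <= e / 2 * M)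
    by (apply Rmult_le_compat_l; [lra|apply HM; lia]).
  assert (e / 2 * 1 <= e / 2 * M) by (apply Rmult_le_compat_l; lra).
  unfold eta in H1. nra.
Qed.

(** The terms of [I_1 (2 sqrt Q) / sqrt Q]. *)
Definition bessel_weight (Q : R) (j : nat) : R :=
  Q ^ j / (INR (fact j) * INR (fact (S j))).

(** Conjugation makes the factors [(- i)^j] of [osc j y] and [osc (j + 1) x]
    compensate each other up to one [- i], so all the leading terms have the same
    argument. *)
Lemma tensor_series_osc_profile (c x y : R) : 0 <= c -> 0 < x -> 0 < y ->
  tensor_series c (fun j => osc (S j)) (conj_seq osc) x y
  = (- Ci * RtoC (x / 2) * Csum (fun j => RtoC (bessel_weight (c * x * y / 4) j)
       * (profile (S j) x * Cconj (profile j y))))%C.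
Proof.
  intros Hc Hx Hy.
  assert (Hx2 : RtoC (x / 2) <> 0) by (intros H; apply RtoC_inj in H; lra).
  assert (Hsum : forall j, (RtoC (c ^ j) * (osc (S j) x * conj_seq osc j y))%C
   = (- Ci * RtoC (x / 2) * (RtoC (bessel_weight (c * x * y / 4) j)
       * (profile (S j) x * Cconj (profile j y))))%C).
  { intros j. unfold conj_seq. rewrite (osc_profile (S j) x Hx), (osc_profile j y Hy).
    rewrite !Cmult_conj, Cpow_S.
    replace (Cconj (RtoC ((y / 2) ^ j / INR (fact j))))
      with (RtoC ((y / 2) ^ j / INR (fact j)))
      by (apply injective_projections; simpl; ring).
    pose proof (INR_fact_lt_0 j). pose proof (INR_fact_lt_0 (S j)).
    transitivity ((- Ci * ((- Ci) ^ j * Cconj ((- Ci) ^ j)) *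
       (RtoC (c ^ j * ((x / 2) ^ S j / INR (fact (S j))) * ((y / 2) ^ j / INR (fact j)))
       * (profile (S j) x * Cconj (profile j y)))))%C.
    { rewrite !RtoC_mult. ring. }
    rewrite <- Cmod2_conj, Cmod_minus_Ci_pow.
    replace (c ^ j * ((x / 2) ^ S j / INR (fact (S j))) * ((y / 2) ^ j / INR (fact j)))
      with (x / 2 * bessel_weight (c * x * y / 4) j).
    { rewrite RtoC_mult, pow1. ring. }
    unfold bessel_weight. replace (c * x * y / 4) with (c * ((x / 2) * (y / 2))) by field.
    rewrite !Rpow_mult_distr. simpl pow. field. lra. }
  unfold tensor_series. rewrite (Csum_ext _ _ Hsum).
  apply Csum_scal.
  pose proof (abs_summable_tensor_series c (fun j => osc (S j)) (conj_seq osc) x y Hc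
    rapid_osc_succ (rapid_conj _ rapid_osc) (Rlt_le _ _ Hx) (Rlt_le _ _ Hy)) as Hs.
  apply abs_summable_le with
    (fun j => / (x / 2) * Cmod (RtoC (c ^ j) * (osc (S j) x * conj_seq osc j y))%C).
  - intros j. rewrite Hsum, (Cmod_mult (- Ci * RtoC (x / 2))).
    rewrite (Cmod_mult (- Ci)), Cmod_opp, Cmod_Ci.
    rewrite (Cmod_R (x / 2)), Rabs_pos_eq by lra. right. field. lra.
  - apply (ex_series_scal_l (K:=R_AbsRing) (V:=R_NormedModule) (/ (x / 2))). exact Hs.
Qed.

(** * Moments of the Bessel weights *)

Lemma ex_series_mult_l (c : R) (a : nat -> R) :
  ex_series a -> ex_series (fun j => c * a j).
Proof. exact (ex_series_scal_l (K:=R_AbsRing) (V:=R_NormedModule) c a). Qed.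

Lemma ex_series_add (a b : nat -> R) :
  ex_series a -> ex_series b -> ex_series (fun j => a j + b j).
Proof. exact (ex_series_plus (V:=R_NormedModule) a b). Qed.

Lemma ex_series_dominated (a b : nat -> R) :
  (forall j, 0 <= a j <= b j) -> ex_series b -> ex_series a.
Proof.
  intros H. apply (ex_series_le (K:=R_AbsRing) (V:=R_CompleteNormedModule)).
  intros j. change (Rabs (a j) <= b j). rewrite Rabs_pos_eq; apply H.
Qed.

Lemma ex_series_from_succ (a : nat -> R) :
  ex_series (fun j => a (S j)) -> ex_series a.
Proof. intros H. now apply (ex_series_incr_1 (V:=R_NormedModule)). Qed.

Lemma bessel_weight_nonneg (Q : R) (j : nat) : 0 <= Q -> 0 <= bessel_weight Q j.
Proof.
  intros HQ. unfold bessel_weight. apply Rdiv_le_0_compat; [now apply pow_le|].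
  apply Rmult_lt_0_compat; apply INR_fact_lt_0.
Qed.

Lemma is_series_exp (y : R) : is_series (fun j => y ^ j / INR (fact j)) (exp y).
Proof.
  apply is_series_ext with (2 := is_exp_Reals y).
  intros j. rewrite pow_n_pow. reflexivity.
Qed.

Lemma bessel_weight_le (y : R) (j : nat) : 0 <= y ->
  bessel_weight (y ^ 2) j <= exp y * (y ^ j / INR (fact j)).
Proof.
  intros Hy. pose proof (INR_fact_lt_0 j) as H1. pose proof (INR_fact_lt_0 (S j)) as H2.
  pose proof (pow_le y j Hy) as H3.
  replace (bessel_weight (y ^ 2) j)
    with (y ^ j / INR (fact (S j)) * (y ^ j / INR (fact j))).
  2: { unfold bessel_weight.
       replace ((y ^ 2) ^ j) with (y ^ j * y ^ j)
         by (rewrite <- pow_mult, Nat.mul_comm, pow_mult; ring).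
       field. lra. }
  apply Rmult_le_compat_r; [now apply Rdiv_le_0_compat|].
  eapply Rle_trans; [|apply (pow_fact_le_exp y j Hy)].
  apply Rmult_le_compat_l; auto. apply Rinv_le_contravar; auto.
  apply le_INR, fact_le. lia.
Qed.

Lemma ex_series_bessel_sq (y : R) : 0 <= y -> ex_series (bessel_weight (y ^ 2)).
Proof.
  intros Hy. apply ex_series_dominated with (fun j => exp y * (y ^ j / INR (fact j))).
  - intros j. split; [apply bessel_weight_nonneg, pow2_ge_0|now apply bessel_weight_le].
  - apply ex_series_mult_l. eexists. apply is_series_exp.
Qed.

Lemma Series_bessel_sq_le (y : R) : 0 <= y ->
  Series (bessel_weight (y ^ 2)) <= exp (2 * y).
Proof.
  intros Hy. replace (exp (2 * y)) with (Series (fun j => exp y * (y ^ j / INR (fact j)))).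
  - apply Series_le.
    + intros j. split; [apply bessel_weight_nonneg, pow2_ge_0|now apply bessel_weight_le].
    + apply ex_series_mult_l. eexists. apply is_series_exp.
  - rewrite Series_scal_l, (is_series_unique _ _ (is_series_exp y)), <- exp_plus.
    f_equal. ring.
Qed.

Definition pronic (j : nat) : R := INR j * (INR j + 1).

Lemma pronic_S (j : nat) : pronic (S j) = pronic j + 2 * (INR j + 1).
Proof. unfold pronic. rewrite S_INR. ring. Qed.

(** Hence multiplying the weights by [pronic] shifts them by one index: this is
    what makes their moments computable. *)
Lemma bessel_weight_rec (Q : R) (j : nat) :
  pronic (S j) * bessel_weight Q (S j) = Q * bessel_weight Q j.
Proof.
  pose proof (INR_fact_lt_0 j). pose proof (pos_INR j).
  unfold bessel_weight, pronic. rewrite (fact_simpl (S j)), (fact_simpl j).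
  rewrite !mult_INR, !S_INR. simpl pow. field. lra.
Qed.

(** Equivalently, the central binomial coefficient of order [2 j + 1] is at least
    [2^(2j+1) / (2j+2)]; it compares the Bessel weights with the terms of
    [cosh]. *)
Lemma fact_double_ge (j : nat) :
  2 * 4 ^ j * (INR (fact j) * INR (fact (S j))) <= INR (fact (2 * S j)).
Proof.
  induction j as [|j IH].
  - simpl. lra.
  - pose proof (pos_INR j) as Hj. pose proof (INR_fact_lt_0 (2 * S j)) as Hg.
    assert (F1 : INR (fact (S (S j))) = (INR j + 2) * INR (fact (S j)))
      by (rewrite (fact_simpl (S j)), mult_INR, !S_INR; ring).
    assert (F2 : INR (fact (S j)) = (INR j + 1) * INR (fact j))
      by (rewrite (fact_simpl j), mult_INR, !S_INR; ring).
    assert (F3 : INR (fact (2 * S (S j)))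
       = (2 * INR j + 4) * (2 * INR j + 3) * INR (fact (2 * S j))).
    { replace (2 * S (S j))%nat with (S (S (2 * S j))) by lia.
      rewrite (fact_simpl (S (2 * S j))), (fact_simpl (2 * S j)).
      rewrite (mult_INR (S (S (2 * S j)))), (mult_INR (S (2 * S j))).
      rewrite (S_INR (S (2 * S j))), (S_INR (2 * S j)).
      replace (INR (2 * S j)) with (2 * INR j + 2)
        by (rewrite mult_INR, (S_INR j); simpl; ring).
      ring. }
    rewrite F3, F1.
    replace (2 * 4 ^ S j * (INR (fact (S j)) * ((INR j + 2) * INR (fact (S j)))))
      with (4 * (INR j + 1) * (INR j + 2)
             * (2 * 4 ^ j * (INR (fact j) * INR (fact (S j)))))
      by (rewrite F2, <- tech_pow_Rmult; ring).
    apply Rle_trans with (4 * (INR j + 1) * (INR j + 2) * INR (fact (2 * S j))).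
    + apply Rmult_le_compat_l; auto. nra.
    + apply Rmult_le_compat_r; [lra|]. nra.
Qed.

Lemma is_series_cosh (y : R) :
  is_series (fun j => y ^ (2 * j) / INR (fact (2 * j))) (cosh y).
Proof.
  set (ev := fun j => / INR (fact (2 * j))). set (od := fun j => / INR (fact (2 * j + 1))).
  assert (Hx : forall y, ex_series (fun j => Rabs (y ^ j / INR (fact j)))).
  { intros z. exists (exp (Rabs z)).
    apply is_series_ext with (2 := is_series_exp (Rabs z)).
    intros j. unfold Rdiv. rewrite Rabs_mult, RPow_abs. f_equal.
    rewrite Rabs_pos_eq; auto. left. apply Rinv_0_lt_compat, INR_fact_lt_0. }
  assert (He : ex_pseries ev (y ^ 2)).
  { apply (ex_series_le (K:=R_AbsRing) (V:=R_CompleteNormedModule))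
      with (fun j => (y ^ 2) ^ j / INR (fact j)).
    2: eexists; apply is_series_exp.
    intros j. unfold ev. rewrite pow_n_pow.
    change (Rabs ((y ^ 2) ^ j * / INR (fact (2 * j))) <= (y ^ 2) ^ j / INR (fact j)).
    pose proof (INR_fact_lt_0 j). pose proof (INR_fact_lt_0 (2 * j)).
    assert (0 <= (y ^ 2) ^ j) by (apply pow_le, pow2_ge_0).
    rewrite Rabs_pos_eq.
    - apply Rmult_le_compat_l; auto. apply Rinv_le_contravar; auto.
      apply le_INR, fact_le. lia.
    - apply Rmult_le_pos; auto. left. now apply Rinv_0_lt_compat. }
  assert (Ho : ex_pseries od (y ^ 2)).
  { apply (ex_series_le (K:=R_AbsRing) (V:=R_CompleteNormedModule))
      with (fun j => (y ^ 2) ^ j / INR (fact j)).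
    2: eexists; apply is_series_exp.
    intros j. unfold od. rewrite pow_n_pow.
    change (Rabs ((y ^ 2) ^ j * / INR (fact (2 * j + 1))) <= (y ^ 2) ^ j / INR (fact j)).
    pose proof (INR_fact_lt_0 j). pose proof (INR_fact_lt_0 (2 * j + 1)).
    assert (0 <= (y ^ 2) ^ j) by (apply pow_le, pow2_ge_0).
    rewrite Rabs_pos_eq.
    - apply Rmult_le_compat_l; auto. apply Rinv_le_contravar; auto.
      apply le_INR, fact_le. lia.
    - apply Rmult_le_pos; auto. left. now apply Rinv_0_lt_compat. }
  destruct He as [l1 Hl1]. destruct Ho as [l2 Hl2].
  pose proof (is_pseries_odd_even (fun n => / INR (fact n)) y l1 l2 Hl1 Hl2) as P1.
  assert (P2 : is_pseries (fun n => / INR (fact n)) (- y) (l1 + - y * l2)).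
  { apply is_pseries_odd_even; replace ((- y) ^ 2) with (y ^ 2) by ring; assumption. }
  assert (E1 : @eq R (exp y) (l1 + y * l2))
    by (rewrite exp_Reals; now apply is_pseries_unique).
  assert (E2 : @eq R (exp (- y)) (l1 + - y * l2))
    by (rewrite exp_Reals; now apply is_pseries_unique).
  assert (Hcosh : forall a b : R, exp y = a + y * b -> exp (- y) = a + - y * b ->
    a = cosh y) by (intros a b Ha Hb; unfold cosh; rewrite Ha, Hb; field).
  pose proof (Hcosh l1 l2 E1 E2) as Hc.
  rewrite <- Hc. apply is_series_ext with (2 := Hl1).
  intros j. rewrite pow_n_pow, <- pow_mult. reflexivity.
Qed.

Section Moments.

Context (rho : R) (hrho : 3 <= rho).
Let Q : R := rho ^ 2 / 4.
Let w : nat -> R := bessel_weight Q.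

Lemma moments_Q_nonneg : 0 <= Q.
Proof. unfold Q. pose proof (pow2_ge_0 rho). lra. Qed.

Lemma moments_weight_nonneg (j : nat) : 0 <= w j.
Proof. apply bessel_weight_nonneg, moments_Q_nonneg. Qed.

Lemma ex_series_weight : ex_series w.
Proof.
  unfold w, Q. replace (rho ^ 2 / 4) with ((rho / 2) ^ 2) by field.
  apply ex_series_bessel_sq. lra.
Qed.

Lemma ex_series_pronic : ex_series (fun j => pronic j * w j).
Proof.
  apply ex_series_from_succ.
  apply (ex_series_ext (V:=R_NormedModule) (fun j => Q * w j)).
  - intros j. symmetry. apply bessel_weight_rec.
  - apply ex_series_mult_l, ex_series_weight.
Qed.

Lemma Series_pronic : Series (fun j => pronic j * w j) = Q * Series w.
Proof.
  rewrite Series_incr_1 by apply ex_series_pronic.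
  rewrite <- Series_scal_l. unfold pronic at 1. simpl INR.
  rewrite !Rmult_0_l, Rplus_0_l. apply Series_ext. intros j. apply bessel_weight_rec.
Qed.

(** [j <= rho] or [j <= j^2 / rho]. *)
Lemma first_moment_pointwise (j : nat) :
  0 <= (INR j + 1) * w j <= (1 + rho) * w j + / rho * (pronic j * w j).
Proof.
  pose proof (moments_weight_nonneg j). pose proof (pos_INR j) as Hj.
  split; [apply Rmult_le_pos; lra|].
  replace ((1 + rho) * w j + / rho * (pronic j * w j))
    with ((1 + rho + pronic j / rho) * w j) by (field; lra).
  apply Rmult_le_compat_r; auto. unfold pronic.
  destruct (Rle_dec (INR j) rho) as [Hr|Hr].
  - assert (0 <= INR j * (INR j + 1) / rho) by (apply Rdiv_le_0_compat; nra). lra.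
  - assert (INR j <= INR j * (INR j + 1) / rho).
    { apply Rle_div_r; [lra|]. nra. }
    lra.
Qed.

Lemma ex_series_first : ex_series (fun j => (INR j + 1) * w j).
Proof.
  eapply ex_series_dominated; [apply first_moment_pointwise|].
  apply ex_series_add; apply ex_series_mult_l; [apply ex_series_weight|apply ex_series_pronic].
Qed.

Lemma Series_weight_ge_1 : 1 <= Series w.
Proof.
  rewrite Series_incr_1 by apply ex_series_weight.
  replace (w 0%nat) with 1 by (unfold w, bessel_weight; simpl; field).
  assert (0 <= Series (fun k => w (S k))).
  { replace 0 with (0 * Series (fun _ => 0)) by ring. rewrite <- Series_scal_l.
    apply Series_le.
    - intros j. pose proof (moments_weight_nonneg (S j)). lra.
    - apply (ex_series_incr_1 (V:=R_NormedModule) w), ex_series_weight. }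
  lra.
Qed.

Lemma Series_first_le : Series (fun j => (INR j + 1) * w j) <= 2 * rho * Series w.
Proof.
  eapply Rle_trans.
  - apply Series_le; [apply first_moment_pointwise|].
    apply ex_series_add; apply ex_series_mult_l;
      [apply ex_series_weight|apply ex_series_pronic].
  - rewrite Series_plus by
      (apply ex_series_mult_l; apply ex_series_weight || apply ex_series_pronic).
    rewrite !Series_scal_l, Series_pronic.
    replace (/ rho * (Q * Series w)) with (rho / 4 * Series w)
      by (unfold Q; field; lra).
    rewrite <- Rmult_plus_distr_r. apply Rmult_le_compat_r; [|lra].
    pose proof Series_weight_ge_1. lra.
Qed.

Lemma variance_pointwise (j : nat) :
  (pronic (S j) - Q) ^ 2 * w (S j)
   = Q * (pronic j * w j) + 2 * Q * ((INR j + 1) * w j) - 2 * Q ^ 2 * w j + Q ^ 2 * w (S j).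
Proof.
  pose proof (bessel_weight_rec Q j) as H. fold (w j) (w (S j)) in H.
  transitivity (pronic (S j) * (pronic (S j) * w (S j))
    - 2 * Q * (pronic (S j) * w (S j)) + Q ^ 2 * w (S j)); [ring|].
  rewrite H, pronic_S. ring.
Qed.

Lemma ex_series_variance : ex_series (fun j => (pronic j - Q) ^ 2 * w j).
Proof.
  apply ex_series_from_succ.
  pose proof moments_Q_nonneg.
  apply ex_series_dominated with (fun j =>
    (Q * (pronic j * w j) + 2 * Q * ((INR j + 1) * w j)) + Q ^ 2 * w (S j)).
  - intros j. split.
    + apply Rmult_le_pos; [apply pow2_ge_0|apply moments_weight_nonneg].
    + rewrite variance_pointwise. pose proof (moments_weight_nonneg j).
      assert (0 <= Q ^ 2 * w j) by (apply Rmult_le_pos; [apply pow2_ge_0|auto]). lra.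
  - apply ex_series_add; [apply ex_series_add|]; apply ex_series_mult_l.
    + apply ex_series_pronic.
    + apply ex_series_first.
    + apply (ex_series_incr_1 (V:=R_NormedModule) w), ex_series_weight.
Qed.

Lemma Series_variance :
  Series (fun j => (pronic j - Q) ^ 2 * w j) = 2 * Q * Series (fun j => (INR j + 1) * w j).
Proof.
  rewrite Series_incr_1 by apply ex_series_variance.
  assert (Hw1 : ex_series (fun j => w (S j)))
    by (apply (ex_series_incr_1 (V:=R_NormedModule) w), ex_series_weight).
  rewrite (Series_ext (fun k => (pronic (S k) - Q) ^ 2 * w (S k))
    (fun j => (Q * (pronic j * w j) + 2 * Q * ((INR j + 1) * w j))
       + (- (2 * Q ^ 2) * w j + Q ^ 2 * w (S j))))
    by (intros j; rewrite variance_pointwise; ring).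
  rewrite Series_plus by (apply ex_series_add; apply ex_series_mult_l;
    auto using ex_series_pronic, ex_series_first, ex_series_weight).
  rewrite !Series_plus by (apply ex_series_mult_l;
    auto using ex_series_pronic, ex_series_first, ex_series_weight).
  rewrite !Series_scal_l, Series_pronic.
  rewrite (Series_incr_1 w) by apply ex_series_weight.
  unfold pronic. simpl INR. ring.
Qed.

Lemma Series_variance_le :
  Series (fun j => (pronic j - Q) ^ 2 * w j) <= rho ^ 3 * Series w.
Proof.
  rewrite Series_variance. pose proof Series_first_le as H.
  apply Rmult_le_compat_l with (r := 2 * Q) in H.
  - eapply Rle_trans; [exact H|]. right. unfold Q. field.
  - pose proof moments_Q_nonneg. lra.
Qed.

(** The Bessel series dominates [2 / rho^2 * (cosh rho - 1)] term by term. *)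
Lemma Series_weight_ge_exp : exp rho / (2 * rho ^ 2) <= Series w.
Proof.
  assert (Hr2 : 0 < rho ^ 2) by (apply pow_lt; lra).
  pose proof (is_series_cosh rho) as Hc.
  assert (Hex : ex_series (fun j => rho ^ (2 * j) / INR (fact (2 * j))))
    by (eexists; exact Hc).
  assert (Hsh : Series (fun j => rho ^ (2 * S j) / INR (fact (2 * S j))) = cosh rho - 1).
  { pose proof (Series_incr_1 _ Hex) as H. rewrite (is_series_unique _ _ Hc) in H.
    replace (rho ^ (2 * 0) / INR (fact (2 * 0))) with 1 in H by (simpl; field).
    lra. }
  assert (Hle : 2 / rho ^ 2 * (cosh rho - 1) <= Series w).
  { rewrite <- Hsh, <- Series_scal_l. apply Series_le; [|apply ex_series_weight].
    intros j. pose proof (INR_fact_lt_0 (2 * S j)) as Hf.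
    assert (Hp : 0 < rho ^ (2 * j)) by (apply pow_lt; lra).
    replace (2 / rho ^ 2 * (rho ^ (2 * S j) / INR (fact (2 * S j))))
      with (rho ^ (2 * j) * (2 / INR (fact (2 * S j)))).
    2: { replace (2 * S j)%nat with (2 + 2 * j)%nat by lia. rewrite pow_add.
         replace (2 + 2 * j)%nat with (2 * S j)%nat by lia. field. lra. }
    split.
    - apply Rmult_le_pos; [lra|]. apply Rdiv_le_0_compat; lra.
    - unfold w, bessel_weight, Q.
      pose proof (INR_fact_lt_0 j) as F1. pose proof (INR_fact_lt_0 (S j)) as F2.
      assert (F3 : 0 < INR (fact j) * INR (fact (S j))) by now apply Rmult_lt_0_compat.
      replace ((rho ^ 2 / 4) ^ j) with (rho ^ (2 * j) * / 4 ^ j)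
        by (rewrite pow_mult; unfold Rdiv; rewrite Rpow_mult_distr, pow_inv; reflexivity).
      assert (F4 : 0 < 4 ^ j) by (apply pow_lt; lra).
      unfold Rdiv at 2. rewrite Rmult_assoc. apply Rmult_le_compat_l; [lra|].
      rewrite <- Rinv_mult. apply Rle_div_l; auto.
      pose proof (fact_double_ge j) as Hfd.
      set (q := INR (fact j) * INR (fact (S j))) in *.
      apply Rmult_le_reg_l with (4 ^ j * q); [now apply Rmult_lt_0_compat|].
      rewrite <- Rmult_assoc, Rinv_r by (apply Rgt_not_eq; now apply Rmult_lt_0_compat).
      lra. }
  eapply Rle_trans; [|exact Hle].
  assert (4 <= exp rho) by (pose proof (exp_ineq1_le rho); lra).
  assert (exp rho / 4 <= cosh rho - 1).
  { unfold cosh. pose proof (exp_pos (- rho)). lra. }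
  apply Rle_trans with (2 / rho ^ 2 * (exp rho / 4)).
  - right. field. lra.
  - apply Rmult_le_compat_l; auto. apply Rdiv_le_0_compat; lra.
Qed.

End Moments.

(** * The lower bound *)

Lemma exp_minus_1_le (h : R) : 0 <= h <= 1 / 2 -> exp h - 1 <= 2 * h.
Proof.
  intros Hh. pose proof (exp_ineq1_le (- h)) as H. rewrite exp_Ropp in H.
  pose proof (exp_pos h) as Hp.
  assert ((1 + - h) * exp h <= 1).
  { apply Rmult_le_compat_r with (r := exp h) in H; [|lra].
    rewrite Rinv_l in H; lra. }
  nra.
Qed.

(** For [j <= 4 rho] the error has three sources: the profile at [y] is replaced by
    [cis y], the profile at [x] by its asymptotic form, and the phase
    [(j+1)^2 / (2 x)] by the common value [rho^2 / (8 x)].  The last difference is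
    not small for all [j], but it is split by Young's inequality into a small
    constant and a multiple of the square that the variance controls. *)
Lemma profile_product_bulk (x y rho : R) (j : nat) :
  0 < x -> 0 < y -> 3 <= rho ->
  3 * (rho / x) <= 1 / 10 -> 32 * (rho ^ 2 / y) <= 1 / 10 -> INR j <= 4 * rho ->
  Cmod (profile (S j) x * Cconj (profile j y)
     - cis (rho ^ 2 / 4 / (2 * x)) * cis x * Cconj (cis y))%C
  <= exp (25 * (rho ^ 2 / x)) * (32 * (rho ^ 2 / y))
     + exp (25 * (rho ^ 2 / x)) * ((9 + 450 * (rho ^ 2 / x)) * (rho / x))
     + 1 / 10 + 3 * (rho / x) + / x ^ 2 * (pronic j - rho ^ 2 / 4) ^ 2.
Proof.
  intros Hx Hy Hrho Hr Hh Hj.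
  pose proof (pos_INR j) as Hj0.
  assert (Hix : 0 < / x) by now apply Rinv_0_lt_compat.
  assert (Hiy : 0 < / y) by now apply Rinv_0_lt_compat.
  set (m := INR (S j)). assert (Hm : m = INR j + 1) by (unfold m; apply S_INR).
  set (M := exp (25 * (rho ^ 2 / x))). set (r := rho / x) in *.
  set (G := rho ^ 2 / x) in *. set (h := rho ^ 2 / y) in *.
  assert (HG : 0 <= G) by (apply Rmult_le_pos; nra).
  assert (Hh0 : 0 <= h) by (apply Rmult_le_pos; nra).
  assert (Hr0 : 0 <= r) by (apply Rmult_le_pos; lra).
  assert (Hmx : exp (m ^ 2 / x) <= M).
  { unfold M. apply exp_le_exp. unfold G.
    replace (25 * (rho ^ 2 / x)) with ((5 * rho) ^ 2 / x) by (field; lra).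
    apply Rmult_le_compat_r; [lra|]. apply pow_incr. lra. }
  assert (HM0 : 0 < M) by apply exp_pos.
  assert (Hstep : phase_incr (S j) x <= 6 * r).
  { unfold phase_incr, r. fold m.
    replace (6 * (rho / x)) with (6 * rho * / x) by (field; lra).
    replace ((2 * m + 1) / (2 * x)) with ((m + / 2) * / x) by (field; lra).
    apply Rmult_le_compat_r; lra. }
  assert (Hst0 : 0 <= phase_incr (S j) x) by now apply phase_incr_nonneg.
  destruct (Cmod_profile_exp (S j) x Hx) as [P1 _]. fold m in P1.
  destruct (Cmod_profile_exp j y Hy) as [_ P2].
  pose proof (profile_asymptotics (S j) x Hx ltac:(lra)) as P3. fold m in P3.
  set (c1 := cis (m ^ 2 / (2 * x))) in *. set (c2 := cis (rho ^ 2 / 4 / (2 * x))).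
  replace (profile (S j) x * Cconj (profile j y) - c2 * cis x * Cconj (cis y))%C
    with (profile (S j) x * Cconj (profile j y - cis y)
      + ((profile (S j) x - c1 * cis x) * Cconj (cis y)
         + (c1 - c2) * (cis x * Cconj (cis y))))%C
    by (rewrite Cminus_conj; ring).
  eapply Rle_trans; [apply Cmod_triangle|].
  eapply Rle_trans; [apply Rplus_le_compat_l, Cmod_triangle|].
  rewrite !Cmod_mult, !Cmod_conj, !Cmod_cis, !Rmult_1_r.
  assert (E1 : Cmod (profile (S j) x) * Cmod (profile j y - cis y)%C <= M * (32 * h)).
  { apply Rmult_le_compat; auto using Cmod_ge_0; [lra|].
    eapply Rle_trans; [exact P2|].
    assert (Hjy : INR j ^ 2 / y <= 16 * h).
    { unfold h. replace (16 * (rho ^ 2 / y)) with ((4 * rho) ^ 2 / y) by (field; lra).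
      apply Rmult_le_compat_r; [lra|]. apply pow_incr; lra. }
    assert (0 <= INR j ^ 2 / y) by (apply Rmult_le_pos; [apply pow2_ge_0|lra]).
    eapply Rle_trans; [apply exp_minus_1_le; lra|]. lra. }
  assert (E2 : Cmod (profile (S j) x - c1 * cis x)%C <= M * ((9 + 450 * G) * r)).
  { eapply Rle_trans; [exact P3|].
    assert (Hs2 : phase_incr (S j) x ^ 2 <= 36 * r ^ 2).
    { replace (36 * r ^ 2) with ((6 * r) ^ 2) by ring. apply pow_incr; lra. }
    assert (Hin : m * (/ (2 * x) + 5 / 2 * phase_incr (S j) x ^ 2) + phase_incr (S j) x
       <= (9 + 450 * G) * r).
    { assert (T1 : m * / (2 * x) <= 5 / 2 * r).
      { unfold r. replace (5 / 2 * (rho / x)) with (5 * rho * / (2 * x)) by (field; lra).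
        apply Rmult_le_compat_r; [left; apply Rinv_0_lt_compat; lra|lra]. }
      assert (T2 : m * (5 / 2 * phase_incr (S j) x ^ 2) <= 5 * rho * (5 / 2 * (36 * r ^ 2))).
      { pose proof (pow2_ge_0 (phase_incr (S j) x)). apply Rmult_le_compat; lra. }
      assert (T3 : rho * r ^ 2 = G * r) by (unfold r, G; field; lra).
      replace (5 * rho * (5 / 2 * (36 * r ^ 2))) with (450 * (rho * r ^ 2)) in T2 by field.
      rewrite T3 in T2. lra. }
    apply Rle_trans with (M *
      (m * (/ (2 * x) + 5 / 2 * phase_incr (S j) x ^ 2) + phase_incr (S j) x)).
    - replace (exp (m ^ 2 / x) * (m * (/ (2 * x) + 5 / 2 * phase_incr (S j) x ^ 2))
               + phase_incr (S j) x)
        with (exp (m ^ 2 / x) * (m * (/ (2 * x) + 5 / 2 * phase_incr (S j) x ^ 2))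
               + 1 * phase_incr (S j) x)
        by ring.
      apply Rmult_le_compat_r; [|exact Hmx].
      assert (0 <= / (2 * x)) by (left; apply Rinv_0_lt_compat; lra).
      pose proof (pow2_ge_0 (phase_incr (S j) x)).
      assert (0 <= m * (/ (2 * x) + 5 / 2 * phase_incr (S j) x ^ 2)) by (apply Rmult_le_pos; lra).
      lra.
    - apply Rmult_le_compat_l; lra. }
  assert (E3 : Cmod (c1 - c2)%C
     <= 1 / 10 + 3 * r + / x ^ 2 * (pronic j - rho ^ 2 / 4) ^ 2).
  { eapply Rle_trans; [apply cis_lipschitz|].
    set (D := pronic j - rho ^ 2 / 4).
    replace (m ^ 2 / (2 * x) - rho ^ 2 / 4 / (2 * x))
      with (D * / (2 * x) + m * / (2 * x)).
    2: { unfold D, pronic. rewrite Hm. field. lra. }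
    eapply Rle_trans; [apply Rabs_triang|].
    assert (T1 : Rabs (m * / (2 * x)) <= 3 * r).
    { rewrite Rabs_pos_eq
        by (apply Rmult_le_pos; [lra|left; apply Rinv_0_lt_compat; lra]).
      unfold r. replace (3 * (rho / x)) with (6 * rho * / (2 * x)) by (field; lra).
      apply Rmult_le_compat_r; [left; apply Rinv_0_lt_compat; lra|lra]. }
    assert (T2 : Rabs (D * / (2 * x)) <= 1 / 10 + / x ^ 2 * D ^ 2).
    { replace (/ x ^ 2 * D ^ 2) with (4 * (D * / (2 * x)) ^ 2) by (field; lra).
      rewrite <- (pow2_abs (D * / (2 * x))). set (a := Rabs (D * / (2 * x))).
      pose proof (pow2_ge_0 (2 * a - 1 / 4)). lra. }
    lra. }
  lra.
Qed.

Lemma exp_sq_le_9 : exp 1 ^ 2 <= 9.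
Proof.
  pose proof exp_le_3. pose proof (exp_pos 1). nra.
Qed.

(** Beyond [j = 4 rho] the factor [exp (2 (j - 4 rho)) >= 1] can be inserted for
    free.  The weight is then that of a Bessel series at [6 rho], whose sum, at most
    [exp (6 rho)], is beaten by [exp (- 8 rho)]. *)
Lemma profile_product_tail (x y rho : R) (j : nat) (u : C) :
  0 < x -> 0 < y -> 3 <= rho -> Cmod u <= 1 -> 4 * rho <= INR j ->
  bessel_weight (rho ^ 2 / 4) j * Cmod (profile (S j) x * Cconj (profile j y) - u)%C
  <= 3 * exp (- (8 * rho)) * bessel_weight ((3 * rho) ^ 2) j.
Proof.
  intros Hx Hy Hrho Hu Hj.
  assert (H1 : Cmod (profile (S j) x * Cconj (profile j y) - u)%C <= 3 * 4 ^ j).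
  { eapply Rle_trans; [apply Cmod_triangle|].
    rewrite Cmod_opp, Cmod_mult, Cmod_conj.
    pose proof (Cmod_profile_pow2 (S j) x Hx). pose proof (Cmod_profile_pow2 j y Hy).
    assert (Cmod (profile (S j) x) * Cmod (profile j y) <= 2 ^ S j * 2 ^ j)
      by (apply Rmult_le_compat; auto using Cmod_ge_0).
    replace (2 ^ S j * 2 ^ j) with (2 * 4 ^ j) in *.
    - assert (1 <= 4 ^ j) by (apply pow_R1_Rle; lra). lra.
    - simpl. replace 4 with (2 * 2) by ring. rewrite Rpow_mult_distr. ring. }
  assert (Hw : 0 <= bessel_weight (rho ^ 2 / 4) j)
    by (apply bessel_weight_nonneg; pose proof (pow2_ge_0 rho); lra).
  assert (H2 : 1 <= exp (- (8 * rho)) * 9 ^ j).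
  { apply Rle_trans with (exp (- (8 * rho)) * exp (2 * INR j)).
    - rewrite <- exp_plus. pose proof (exp_ineq1_le (- (8 * rho) + 2 * INR j)). lra.
    - apply Rmult_le_compat_l; [left; apply exp_pos|].
      replace (exp (2 * INR j)) with ((exp 1 ^ 2) ^ j).
      + apply pow_incr. split; [apply pow2_ge_0|apply exp_sq_le_9].
      + rewrite <- pow_mult.
        replace (2 * INR j) with (INR (2 * j)) by (rewrite mult_INR; simpl; ring).
        generalize (2 * j)%nat as n. induction n as [|n IH].
        * simpl. now rewrite exp_0.
        * rewrite S_INR, exp_plus, <- IH. simpl. ring. }
  apply Rle_trans with (bessel_weight (rho ^ 2 / 4) j * (3 * 4 ^ j)).
  - now apply Rmult_le_compat_l.
  - replace (bessel_weight ((3 * rho) ^ 2) j)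
      with (bessel_weight (rho ^ 2 / 4) j * (4 ^ j * 9 ^ j)).
    + assert (0 < 4 ^ j) by (apply pow_lt; lra).
      replace (3 * exp (- (8 * rho)) * (bessel_weight (rho ^ 2 / 4) j * (4 ^ j * 9 ^ j)))
        with (bessel_weight (rho ^ 2 / 4) j * (3 * 4 ^ j * (exp (- (8 * rho)) * 9 ^ j)))
        by ring.
      apply Rmult_le_compat_l; auto. nra.
    + unfold bessel_weight.
      replace ((3 * rho) ^ 2) with (rho ^ 2 / 4 * (4 * 9)) by field.
      rewrite (Rpow_mult_distr (rho ^ 2 / 4)), (Rpow_mult_distr 4).
      field. split; apply Rgt_not_eq, INR_fact_lt_0.
Qed.

Lemma profile_sum_lower (x y rho : R) : 0 < x -> 0 < y -> 3 <= rho ->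
  exp (25 * (rho ^ 2 / x)) * (32 * (rho ^ 2 / y)) <= 1 / 10 ->
  exp (25 * (rho ^ 2 / x)) * ((9 + 450 * (rho ^ 2 / x)) * (rho / x))
    + (3 + rho ^ 2 / x) * (rho / x) <= 1 / 10 ->
  Series (bessel_weight (rho ^ 2 / 4)) / 2
  <= Cmod (Csum (fun j => RtoC (bessel_weight (rho ^ 2 / 4) j)
              * (profile (S j) x * Cconj (profile j y)))%C).
Proof.
  intros Hx Hy Hrho H1 H2.
  set (w := bessel_weight (rho ^ 2 / 4)).
  set (u := (cis (rho ^ 2 / 4 / (2 * x)) * cis x * Cconj (cis y))%C).
  assert (Hu : Cmod u = 1)
    by (unfold u; rewrite !Cmod_mult, Cmod_conj, !Cmod_cis; ring).
  assert (Hix : 0 < / x) by now apply Rinv_0_lt_compat.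
  assert (Hiy : 0 < / y) by now apply Rinv_0_lt_compat.
  assert (HG : 0 <= rho ^ 2 / x) by (apply Rmult_le_pos; nra).
  assert (Hh : 0 <= rho ^ 2 / y) by (apply Rmult_le_pos; nra).
  assert (Hr : 0 <= rho / x) by (apply Rmult_le_pos; lra).
  assert (HM : 1 <= exp (25 * (rho ^ 2 / x)))
    by (pose proof (exp_ineq1_le (25 * (rho ^ 2 / x))); lra).
  set (M := exp (25 * (rho ^ 2 / x))) in *.
  assert (Hw0 : forall j, 0 <= w j) by (intros j; now apply moments_weight_nonneg).
  assert (Hb1 : 32 * (rho ^ 2 / y) <= 1 / 10) by nra.
  assert (Hb2 : 3 * (rho / x) <= 1 / 10).
  { assert (0 <= M * ((9 + 450 * (rho ^ 2 / x)) * (rho / x)))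
      by (apply Rmult_le_pos; [lra|apply Rmult_le_pos; lra]).
    assert (0 <= rho ^ 2 / x * (rho / x)) by now apply Rmult_le_pos. lra. }
  set (kap := M * (32 * (rho ^ 2 / y)) + M * ((9 + 450 * (rho ^ 2 / x)) * (rho / x))
     + 1 / 10 + 3 * (rho / x)).
  assert (Hkap : 0 <= kap).
  { unfold kap. assert (0 <= M * ((9 + 450 * (rho ^ 2 / x)) * (rho / x)))
      by (apply Rmult_le_pos; [lra|apply Rmult_le_pos; lra]).
    assert (0 <= M * (32 * (rho ^ 2 / y))) by (apply Rmult_le_pos; lra). lra. }
  assert (Hix2 : 0 < / x ^ 2) by (apply Rinv_0_lt_compat, pow_lt; auto).
  assert (He8 : 0 < exp (- (8 * rho))) by apply exp_pos.
  set (b := fun j => (kap * w j + / x ^ 2 * ((pronic j - rho ^ 2 / 4) ^ 2 * w j))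
     + 3 * exp (- (8 * rho)) * bessel_weight ((3 * rho) ^ 2) j).
  assert (Hpt : forall j, Cmod (RtoC (w j) * (profile (S j) x * Cconj (profile j y) - u))%C
     <= b j).
  { intros j. rewrite Cmod_mult, Cmod_R, Rabs_pos_eq by auto.
    assert (Hb9 : 0 <= bessel_weight ((3 * rho) ^ 2) j)
      by apply bessel_weight_nonneg, pow2_ge_0.
    pose proof (Hw0 j) as Hwj.
    assert (0 <= (pronic j - rho ^ 2 / 4) ^ 2 * w j)
      by (apply Rmult_le_pos; [apply pow2_ge_0|auto]).
    assert (0 <= / x ^ 2 * ((pronic j - rho ^ 2 / 4) ^ 2 * w j))
      by (apply Rmult_le_pos; lra).
    assert (0 <= 3 * exp (- (8 * rho)) * bessel_weight ((3 * rho) ^ 2) j)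
      by (apply Rmult_le_pos; lra).
    assert (0 <= kap * w j) by now apply Rmult_le_pos.
    unfold b. destruct (Rle_dec (INR j) (4 * rho)) as [Hj|Hj].
    - pose proof (profile_product_bulk x y rho j Hx Hy Hrho Hb2 Hb1 Hj) as Hp.
      fold M u in Hp. fold kap in Hp.
      apply Rmult_le_compat_l with (r := w j) in Hp; auto. lra.
    - assert (Hj' : 4 * rho <= INR j) by lra.
      pose proof (profile_product_tail x y rho j u Hx Hy Hrho (Req_le _ _ Hu) Hj') as Hp.
      fold w in Hp. lra. }
  assert (Hex1 : ex_series w) by now apply ex_series_weight.
  assert (Hex2 : ex_series (fun j => (pronic j - rho ^ 2 / 4) ^ 2 * w j))
    by now apply ex_series_variance.
  assert (Hex3 : ex_series (bessel_weight ((3 * rho) ^ 2)))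
    by (apply ex_series_bessel_sq; lra).
  assert (Hexb : ex_series b).
  { unfold b. apply ex_series_add; [apply ex_series_add|]; now apply ex_series_mult_l. }
  assert (Hsum1 : abs_summable (fun j => RtoC (w j) * u)%C).
  { apply abs_summable_le with w; auto. intros j.
    rewrite Cmod_mult, Hu, Cmod_R, Rabs_pos_eq; auto. lra. }
  assert (Hsumd := abs_summable_le _ b Hpt Hexb).
  assert (Hsplit : Csum (fun j => RtoC (w j) * (profile (S j) x * Cconj (profile j y)))%C
    = (Csum (fun j => RtoC (w j) * (profile (S j) x * Cconj (profile j y) - u))
       + Csum (fun j => RtoC (w j) * u))%C).
  { rewrite (Csum_ext _ (fun j => 1 * (RtoC (w j)
        * (profile (S j) x * Cconj (profile j y) - u)) + RtoC (w j) * u)%C)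
      by (intros; ring).
    rewrite Csum_lin by assumption. now rewrite Cmult_1_l. }
  assert (Hmain : Csum (fun j => RtoC (w j) * u)%C = (u * RtoC (Series w))%C).
  { rewrite (Csum_ext _ (fun j => u * RtoC (w j))%C) by (intros; ring).
    rewrite Csum_scal.
    - f_equal. unfold Csum. simpl. apply injective_projections; simpl; auto.
      rewrite (Series_ext (fun _ => 0) (fun _ => 0 * 0)) by (intros; ring).
      rewrite Series_scal_l. ring.
    - apply abs_summable_le with w; auto. intros j.
      rewrite Cmod_R, Rabs_pos_eq; auto. lra. }
  assert (HS1 : 1 <= Series w) by now apply Series_weight_ge_1.
  assert (Herr : Series b <= Series w / 2).
  { unfold b. rewrite Series_plus, Series_plus, !Series_scal_l
      by (try apply ex_series_add; now apply ex_series_mult_l).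
    pose proof (Series_variance_le rho Hrho) as Hv. fold w in Hv.
    assert (Hv2 : / x ^ 2 * Series (fun j => (pronic j - rho ^ 2 / 4) ^ 2 * w j)
      <= (rho ^ 2 / x) * (rho / x) * Series w).
    { eapply Rle_trans; [apply Rmult_le_compat_l; [lra|exact Hv]|].
      right. field. lra. }
    assert (Ht : 3 * exp (- (8 * rho)) * Series (bessel_weight ((3 * rho) ^ 2))
      <= 3 / 16).
    { apply Rle_trans with (3 * exp (- (8 * rho)) * exp (2 * (3 * rho))).
      - apply Rmult_le_compat_l; [lra|]. apply Series_bessel_sq_le. lra.
      - rewrite Rmult_assoc, <- exp_plus.
        replace (- (8 * rho) + 2 * (3 * rho)) with (- (2 * rho)) by ring.
        rewrite exp_Ropp. replace (2 * rho) with (rho + rho) by ring.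
        rewrite exp_plus. pose proof (exp_ineq1_le rho).
        assert (16 <= exp rho * exp rho) by nra.
        assert (/ (exp rho * exp rho) <= / 16) by (apply Rinv_le_contravar; lra).
        lra. }
    assert (kap * Series w + (rho ^ 2 / x) * (rho / x) * Series w <= 3 / 10 * Series w).
    { rewrite <- Rmult_plus_distr_r. apply Rmult_le_compat_r; [lra|].
      unfold kap. lra. }
    lra. }
  rewrite Hsplit, Hmain.
  pose proof (Cmod_Csum_le _ b Hpt Hexb) as Hle.
  set (d := Csum (fun j => RtoC (w j) * (profile (S j) x * Cconj (profile j y) - u))%C) in *.
  assert (Hn : Cmod (u * RtoC (Series w))%C = Series w)
    by (rewrite Cmod_mult, Hu, Cmod_R, Rabs_pos_eq; lra).
  assert (Htri : Cmod (u * RtoC (Series w))%C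
     <= Cmod (d + u * RtoC (Series w))%C + Cmod d).
  { replace (u * RtoC (Series w))%C with (d + u * RtoC (Series w) + - d)%C at 1 by ring.
    eapply Rle_trans; [apply Cmod_triangle|]. rewrite Cmod_opp. lra. }
  lra.
Qed.

Lemma Rpower_rho_le (rho : R) : 1 <= rho -> Rpower rho (- (5 / 2)) <= / rho ^ 2.
Proof.
  intros H. rewrite <- (Rpower_pow 2 rho) by lra. rewrite <- Rpower_Ropp.
  destruct (Req_dec rho 1) as [->|Hne].
  - unfold Rpower. rewrite ln_1, !Rmult_0_r. lra.
  - left. apply Rpower_lt; [lra|]. simpl. lra.
Qed.

(** Since [rho^2 = 2 k A z t], the ratio [rho^2 / x] at [x = k t] is [2 A z], and
    the ratio [rho^2 / y] at [y = k^2 z] is [2 A t / k]. *)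
Lemma sol_n_lower (E : C) (k t z : R) : 0 < k -> 1 / 2 <= t -> 0 < z -> E <> 0 ->
  3 <= rho E k t z ->
  exp (25 * (2 * Cmod E ^ 2 * z)) * (32 * (2 * Cmod E ^ 2 * t / k)) <= 1 / 10 ->
  exp (25 * (2 * Cmod E ^ 2 * z)) * ((9 + 450 * (2 * Cmod E ^ 2 * z)) * (rho E k t z / (k * t)))
    + (3 + 2 * Cmod E ^ 2 * z) * (rho E k t z / (k * t)) <= 1 / 10 ->
  Cmod E / 16 * (k * Rpower (rho E k t z) (- (5 / 2)) * exp (rho E k t z))
    <= Cmod (sol_n E k t z).
Proof.
  intros Hk Ht Hz HE Hrho H1 H2.
  set (r := rho E k t z) in *.
  assert (Hkt : 0 < k * t) by (apply Rmult_lt_0_compat; lra).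
  assert (Hkz : 0 < k ^ 2 * z) by (apply Rmult_lt_0_compat; [apply pow_lt|]; lra).
  assert (HE0 : 0 < Cmod E) by now apply Cmod_gt_0.
  assert (HE2 : 0 < Cmod E ^ 2) by now apply pow_lt.
  assert (Hr2 : r ^ 2 = 2 * k * Cmod E ^ 2 * z * t).
  { unfold r, rho. rewrite pow2_sqrt; auto.
    repeat apply Rmult_le_pos; lra. }
  assert (Hc : 0 <= coupling E k) by now apply coupling_nonneg.
  rewrite sol_n_eq by (auto; lra).
  rewrite tensor_series_osc_profile by assumption.
  replace (coupling E k * (k * t) * (k ^ 2 * z) / 4) with (r ^ 2 / 4)
    by (rewrite Hr2; unfold coupling; field; lra).
  replace (2 * Cmod E ^ 2 * z) with (r ^ 2 / (k * t)) in H1, H2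
    by (rewrite Hr2; field; lra).
  replace (2 * Cmod E ^ 2 * t / k) with (r ^ 2 / (k ^ 2 * z)) in H1
    by (rewrite Hr2; field; lra).
  pose proof (profile_sum_lower (k * t) (k ^ 2 * z) r Hkt Hkz Hrho H1 H2) as Hlow.
  pose proof (Series_weight_ge_exp r Hrho) as HS.
  rewrite !Cmod_mult, !Cmod_opp, Cmod_conj, Cmod_Ci, Cmod_R, Rabs_pos_eq by lra.
  pose proof (Rpower_rho_le r ltac:(lra)) as Hp.
  set (N := Cmod (Csum _)) in *.
  assert (Hr0 : 0 < r ^ 2) by (apply pow_lt; lra).
  pose proof (exp_pos r) as Her.
  assert (HN : exp r * / r ^ 2 / 4 <= N).
  { replace (exp r * / r ^ 2 / 4) with (exp r / (2 * r ^ 2) / 2) by (field; lra). lra. }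
  apply Rle_trans with (Cmod E / 16 * (k * / r ^ 2 * exp r)).
  - apply Rmult_le_compat_l; [lra|]. apply Rmult_le_compat_r; [lra|].
    apply Rmult_le_compat_l; lra.
  - replace (Cmod E / 16 * (k * / r ^ 2 * exp r))
      with (Cmod E * ((k / 4) * (exp r * / r ^ 2 / 4))) by (field; lra).
    apply Rmult_le_compat_l; [lra|]. rewrite Rmult_1_l.
    assert (0 <= exp r * / r ^ 2 / 4).
    { apply Rmult_le_pos; [|lra]. apply Rmult_le_pos; [lra|].
      left. now apply Rinv_0_lt_compat. }
    apply Rmult_le_compat; try lra. nra.
Qed.

Theorem theorem1p1 (E : C) (hE : E <> RtoC 0) :
  exists u0 : R -> R -> C,
    (forall k t : R, 0 <= t -> Cmod (u0 k t) <= 1) /\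
    (forall xi : R * R, exists u v n : R -> R -> C,
       zakharov_solution E (freq xi) (u0 (freq xi)) (fun _ => RtoC 0) u v n) /\
    exists c rho0 : R, 0 < c /\ 0 < rho0 /\
      forall T Z : R, exists K : R, 0 < K /\
        forall (xi : R * R) (u v n : R -> R -> C), K <= freq xi ->
          zakharov_solution E (freq xi) (u0 (freq xi)) (fun _ => RtoC 0) u v n ->
          forall t z : R, 1 / 2 <= t <= T -> 0 <= z <= Z ->
            rho0 <= rho E (freq xi) t z ->
            c * (freq xi * Rpower (rho E (freq xi) t z) (- (5 / 2))
                 * exp (rho E (freq xi) t z))
              <= Cmod (n t z).
Proof.
  exists (fun k t => cis (k * t)).
  assert (HE0 : 0 < Cmod E) by now apply Cmod_gt_0.
  split; [|split].
  - intros k t _. rewrite Cmod_cis. lra.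
  - intros xi. assert (Hf : 0 <= freq xi) by apply sqrt_pos.
    destruct (Req_dec (freq xi) 0) as [H0|H0].
    + rewrite H0. do 3 eexists. apply zakharov_exists_0.
    + do 3 eexists. apply zakharov_exists; auto. lra.
  - exists (Cmod E / 16), 3. split; [lra|]. split; [lra|]. intros T Z.
    set (A := Cmod E ^ 2). assert (HA : 0 < A) by now apply pow_lt.
    set (T' := Rabs T + 1). set (Z' := Rabs Z + 1).
    pose proof (Rabs_pos T) as HT. pose proof (Rabs_pos Z) as HZ.
    set (G := 2 * A * Z'). assert (HG : 0 < G) by (unfold G, Z'; nra).
    set (M := exp (25 * G)). assert (HM : 0 < M) by apply exp_pos.
    set (L := 10 * (M * (9 + 450 * G) + (3 + G))).
    assert (HL : 0 < L) by (unfold L; nra).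
    set (K1 := 2 * G * L ^ 2). set (K2 := 640 * M * A * T').
    assert (HK1 : 0 < K1) by (unfold K1; assert (0 < L ^ 2) by (now apply pow_lt); nra).
    assert (HK2 : 0 < K2)
      by (unfold K2, T'; repeat apply Rmult_lt_0_compat; lra).
    exists (K1 + K2). split; [lra|].
    intros xi u v n HK Hsol t z Ht Hz Hrho. set (k := freq xi) in *.
    assert (Hk : 0 < k) by lra.
    assert (Hz0 : 0 < z).
    { destruct (Req_dec z 0) as [->|]; [|lra]. exfalso.
      unfold rho in Hrho. rewrite Rmult_0_r, Rmult_0_l, sqrt_0 in Hrho. lra. }
    rewrite (zakharov_unique _ _ _ _ _ _ _ _ _ _ Hsol (zakharov_exists E k hE Hk) t z)
      by lra.
    assert (HtT : t <= T') by (unfold T'; pose proof (Rle_abs T); lra).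
    assert (HzZ : z <= Z') by (unfold Z'; pose proof (Rle_abs Z); lra).
    assert (Hkt : 0 < k * t) by (apply Rmult_lt_0_compat; lra).
    assert (HzG : 0 <= 2 * A * z <= G).
    { split; [repeat apply Rmult_le_pos; lra|]. unfold G.
      apply Rmult_le_compat_l; lra. }
    assert (HMz : exp (25 * (2 * A * z)) <= M) by (apply exp_le_exp; lra).
    set (q := rho E k t z / (k * t)).
    assert (Hq0 : 0 <= q) by (apply Rdiv_le_0_compat; [lra|auto]).
    assert (Hq2 : q ^ 2 = 2 * A * z / (k * t)).
    { unfold q, Rdiv. rewrite Rpow_mult_distr. unfold rho. rewrite pow2_sqrt.
      - unfold A. field. lra.
      - fold A. repeat apply Rmult_le_pos; lra. }
    (* [q^2 = 2 A z / (k t)], so [q] is of order [k^(-1/2)]. *)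
    assert (Hq : q * L <= 1).
    { apply Rnot_lt_le. intros Habs.
      assert (H1 : 1 < (q * L) ^ 2) by nra.
      rewrite Rpow_mult_distr, Hq2 in H1.
      assert (HL2 : 0 < L ^ 2) by now apply pow_lt.
      assert (H2 : 2 * A * z / (k * t) <= 2 * G / k).
      { apply Rle_div_l; [auto|].
        replace (2 * G / k * (k * t)) with (2 * G * t) by (field; lra). nra. }
      assert (H3 : 2 * G / k * L ^ 2 <= 1).
      { replace (2 * G / k * L ^ 2) with (K1 / k) by (unfold K1; field; lra).
        apply Rle_div_l; lra. }
      assert (2 * A * z / (k * t) * L ^ 2 <= 2 * G / k * L ^ 2)
        by (apply Rmult_le_compat_r; lra).
      lra. }
    apply sol_n_lower; auto; try lra; fold A.
    + assert (H1 : 2 * A * t / k <= 2 * A * T' / k).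
      { apply Rmult_le_compat_r; [left; now apply Rinv_0_lt_compat|].
        apply Rmult_le_compat_l; lra. }
      assert (H2 : M * (32 * (2 * A * T' / k)) <= 1 / 10).
      { replace (M * (32 * (2 * A * T' / k))) with (K2 / 10 / k) by (unfold K2; field; lra).
        apply Rle_div_l; lra. }
      eapply Rle_trans; [|exact H2].
      apply Rmult_le_compat; try lra; [left; apply exp_pos|].
      apply Rmult_le_pos; [lra|]. apply Rdiv_le_0_compat; [|auto].
      repeat apply Rmult_le_pos; lra.
    + fold q.
      assert (H1 : exp (25 * (2 * A * z)) * ((9 + 450 * (2 * A * z)) * q)
         <= M * ((9 + 450 * G) * q)).
      { apply Rmult_le_compat; auto; [left; apply exp_pos| |].
        - apply Rmult_le_pos; lra.
        - apply Rmult_le_compat_r; lra. }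
      assert (H2 : (3 + 2 * A * z) * q <= (3 + G) * q) by (apply Rmult_le_compat_r; lra).
      unfold L in Hq. lra.
Qed.
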